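(* Suppose that $K$ is closed at infinity, that $f$ is positive at infinity on $K$, and that the POP $\inf\{f(\mathbf{x}):\mathbf{x}\in K\}$ admits a correlative sparsity pattern $(\mathbf{x}(1),\dots,\mathbf{x}(p))$. Then $\bar f_k\rightarrow f_{\min}$ as $k\rightarrow\infty$.
   Context: Polynomial optimization problem (POP). Let $\mathbf{x}=(x_1,\dots,x_n)$, $f,g_1,\dots,g_m\in\mathbb{R}[\mathbf{x}]$, $K=\{\mathbf{x}\in\mathbb{R}^n : g_j(\mathbf{x})\ge 0,\ j=1,\dots,m\}$, $f_{\min}=\inf_{\mathbf{x}\in K} f(\mathbf{x})$; it is assumed throughout that $f_{\min}>-\infty$. Put $d=\deg(f)$. Homogenization. Let $\tilde{\mathbf{x}}=(x_0,x_1,\dots,x_n)$. For $q\in\mathbb{R}[\mathbf{x}]$, $\tilde q(\tilde{\mathbf{x}})=x_0^{\deg(q)}q(\mathbf{x}/x_0)$ and $q^{(\infty)}$ is the homogeneous part of $q$ of degree $\deg(q)$. Define $\widetilde K=\{\tilde{\mathbf{x}}\in\mathbb{R}^{n+1} : \tilde g_j(\tilde{\mathbf{x}})\ge 0\ (j=1,\dots,m),\ x_0\ge 0,\ \|\tilde{\mathbf{x}}\|^2=1\}$. $K$ is closed at infinity if $\widetilde K$ equals the closure of $\widetilde K\cap\{x_0>0\}$. Let $K^{(\infty)}=\{\mathbf{x}\in\mathbb{R}^n : g_j^{(\infty)}(\mathbf{x})\ge0\ (j=1,\dots,m),\ \|\mathbf{x}\|^2=1\}$. The polynomial $f$ is positive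 (definite) at infinity on $K$ if $f^{(\infty)}>0$ on $K^{(\infty)}$. Correlative sparsity. Variable sets $\mathbf{x}(1),\dots,\mathbf{x}(p)\subseteq\{x_1,\dots,x_n\}$ with union $\{x_1,\dots,x_n\}$ form a correlative sparsity pattern (csp) of the POP if $f=\sum_{\ell=1}^p f_\ell$ with $f_\ell\in\mathbb{R}[\mathbf{x}(\ell)]$, and $\{1,\dots,m\}$ can be partitioned into $p$ (possibly empty) sets such that each $g_j$ with $j$ in the $\ell$-th set lies in $\mathbb{R}[\mathbf{x}(\ell)]$. (No running intersection property is assumed for this csp.) Let $p_i$ be the number of $\ell\in\{1,\dots,p\}$ with $x_i\in\mathbf{x}(\ell)$. Reformulation without perturbation. Let $\mathbf{w}=(w_1,\dots,w_p)$ be auxiliary variables, and $$h'_\ell=\sum_{x_i\in\mathbf{x}(\ell)}\tfrac1{p_i}x_i^2+\tfrac1p x_0^2+w_\ell^2-1\ (\ell=1,\dots,p),\qquad h'_{p+1}=\|\mathbf{w}\|^2-p+1.$$ Let $\widetilde K_s^2$ be the set of $(\tilde{\mathbf{x}},\mathbf{w})\in\mathbb{R}^{n+1+p}$ with $x_0\ge0$, $\tilde g_j(\tilde{\mathbf{x}})\ge0$ $(j=1,\dots,m)$, $h'_\ell=0$ $(\ell=1,\dots,p+1)$, $1-x_i^2\ge0$ $(i=0,\dots,n)$, $1-w_\ell^2\ge0$ $(\ell=1,\dots,p)$. The reformulation is to maximize $\gamma$ subject to $\tilde f-\gamma x_0^d\ge0$ on $\widetilde K_s^2$. Cliques. Let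 $\mathbf{u}=(\tilde{\mathbf{x}},\mathbf{w})$. The csp graph of this reformulation has the variables in $\mathbf{u}$ as vertices, two variables being adjacent if they occur together in a monomial of $\tilde f-\gamma x_0^d$ or both occur in the same constraint polynomial defining $\widetilde K_s^2$. Let $\mathbf{u}(1),\dots,\mathbf{u}(q)$ be the list of maximal cliques of some chordal extension (a chordal graph on the same vertices containing all edges) of this graph. Let $\{J_1,\dots,J_q\}$ be a partition of $\{1,\dots,m\}$ (parts may be empty) with $\tilde g_j\in\mathbb{R}[\mathbf{u}(\ell)]$ for $j\in J_\ell$, and $\{I_1,\dots,I_q\}$ a partition of $\{1,\dots,p+1\}$ with $h'_j\in\mathbb{R}[\mathbf{u}(\ell)]$ for $j\in I_\ell$. SOS relaxations. For a set of variables $V$, $\Sigma[V]$ denotes the sums of squares in $\mathbb{R}[V]$, and $\mathbb{R}[V]_s$, $\Sigma[V]_s$ the elements of degree at most $s$. For finite $H,G\subset\mathbb{R}[V]$, $$\mathrm{Ideal}[H,V]_{2k}=\sum_{h\in H}h\cdot\mathbb{R}[V]_{2k-\deg(h)},\qquad \mathrm{QM}[G,V]_{2k}=\Sigma[V]_{2k}+\sum_{g\in G} g\cdot\Sigma[V]_{2k-2\lceil\deg(g)/2\rceil}.$$ For each integer $k\ge\max\{\lceil d/2\rceil,\lceil\deg(g_1)/2\rceil,\dots,\lceil\deg(g_m)/2\rceil\}$, $\bar f_k$ is the supremum of all $\gamma\in\mathbb{R}$ such that $$\tilde f-\gamma x_0^d\in\sum_{\ell=1}^q\mathrm{Ideal}[\{h'_j\}_{j\in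 I_\ell},\mathbf{u}(\ell)]_{2k}+\sum_{\ell=1}^q\mathrm{QM}[\{x_0\}\cup\{1-u_i^2\}_{u_i\in\mathbf{u}(\ell)}\cup\{\tilde g_j\}_{j\in J_\ell},\mathbf{u}(\ell)]_{2k}.$$ *)

(* Defs.v *)
From mathcomp Require Import all_boot all_order all_algebra.
From mathcomp Require Import all_classical all_reals all_analysis.
(* The notations of mpoly clash with those of MathComp-Analysis; its type
   {mpoly R[n]} is therefore written [mpoly n R]. *)
From mathcomp Require Import -(notations) mpoly.

Set Implicit Arguments.
Unset Strict Implicit.
Unset Printing Implicit Defensive.

Import Order.TTheory GRing.Theory Num.Theory.
Import numFieldNormedType.Exports.
Local Open Scope ring_scope.

Section Polynomials.
Variable R : realType.

(* With this convention the degree of the zero polynomial is 0. *)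
Definition degree n (p : mpoly n R) : nat := (mmeasure mdeg p).-1.

Definition mvar n (i : 'I_n) : mpoly n R := mpolyX R (mnm1 i).

Definition eval n (p : mpoly n R) (x : 'rV[R]_n) : R :=
  meval (fun i => x ord0 i) p.

Definition mono_vars n (m : multinom n) : {set 'I_n} :=
  finset (fun i => m i != 0%N).

Definition vars n (p : mpoly n R) : {set 'I_n} :=
  \bigcup_(m <- msupp p) mono_vars m.

Definition in_polyring n (V : {set 'I_n}) (p : mpoly n R) : Prop :=
  vars p \subset V.

(* R[V]_s.  The bound s is an integer: as [mmeasure mdeg] is 1 + the degree
   and vanishes only at 0, R[V]_s = {0} when s < 0. *)
Definition in_polyring_deg n (V : {set 'I_n}) (s : int) (p : mpoly n R) : Prop :=
  in_polyring V p /\ (mmeasure mdeg p)%:Z <= s + 1.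

Definition in_sos_deg n (V : {set 'I_n}) (s : int) (p : mpoly n R) : Prop :=
  in_polyring_deg V s p /\
  exists2 t : seq (mpoly n R),
    (forall r, r \in t -> in_polyring V r) & p = \sum_(r <- t) r ^+ 2.

(* Finite sets of polynomials are given by lists; [undup] discards repetitions. *)
Definition in_ideal n (H : seq (mpoly n R)) (V : {set 'I_n}) (k : nat)
    (p : mpoly n R) : Prop :=
  exists2 c : mpoly n R -> mpoly n R,
    (forall h, h \in H ->
       in_polyring_deg V ((2 * k)%:Z - (degree h)%:Z) (c h))
    & p = \sum_(h <- undup H) h * c h.

(* [uphalf a] is the ceiling of a / 2. *)
Definition in_qmodule n (G : seq (mpoly n R)) (V : {set 'I_n}) (k : nat)
    (p : mpoly n R) : Prop :=
  exists (s0 : mpoly n R) (s : mpoly n R -> mpoly n R),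
    [/\ in_sos_deg V (2 * k)%:Z s0,
        (forall g, g \in G ->
           in_sos_deg V ((2 * k)%:Z - (2 * uphalf (degree g))%:Z) (s g))
      & p = s0 + \sum_(g <- undup G) g * s g].

(* x_0 has index [ord0], and x_i has index [lift ord0 i]. *)
Definition homogenize n (p : mpoly n R) : mpoly n.+1 R :=
  \sum_(m <- msupp p)
     mcoeff m p *: (mvar ord0 ^+ (degree p - mdeg m)
                    * \prod_(i < n) mvar (lift ord0 i) ^+ m i).

Definition top_form n (p : mpoly n R) : mpoly n R :=
  pihomog mdeg (degree p) p.

Definition rename n N (s : 'I_n -> 'I_N) (p : mpoly n R) : mpoly N R :=
  mmap (@mpolyC N R) (fun i => mvar (s i)) p.

End Polynomials.

Section POP.
Variables (R : realType) (n m : nat) (f : mpoly n R) (g : 'I_m -> mpoly n R).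

Definition feasible : set 'rV[R]_n :=
  [set x | forall j, 0 <= eval (g j) x]%classic.

Definition f_min : \bar R :=
  ereal_inf [set (eval f x)%:E | x in feasible]%classic.

Definition feasible_tilde : set 'rV[R]_n.+1 :=
  [set x | [/\ forall j, 0 <= eval (homogenize (g j)) x,
               0 <= x ord0 ord0
             & \sum_i x ord0 i ^+ 2 = 1]]%classic.

Definition closed_at_infinity : Prop :=
  feasible_tilde =
  closure (feasible_tilde `&` [set x | 0 < x ord0 ord0])%classic.

Definition feasible_infty : set 'rV[R]_n :=
  [set x | (forall j, 0 <= eval (top_form (g j)) x)
           /\ \sum_i x ord0 i ^+ 2 = 1]%classic.

Definition positive_at_infinity : Prop :=
  forall x, feasible_infty x -> 0 < eval (top_form f) x.

(* A partition of the constraint indices into p possibly empty parts is the map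
   sending each index to the part containing it. *)
Definition is_csp p (X : 'I_p -> {set 'I_n}) : Prop :=
  [/\ \bigcup_l X l = [set: 'I_n],
      exists2 F : 'I_p -> mpoly n R,
        (forall l, in_polyring (X l) (F l)) & f = \sum_l F l
    & exists part : 'I_m -> 'I_p,
        forall j, in_polyring (X (part j)) (g j)].

End POP.

Section Graphs.
Variables (T : finType) (e : rel T).

Definition chordal : Prop :=
  forall s : seq T, (4 <= size s)%N -> uniq s -> cycle e s ->
  exists x y, [/\ x \in s, y \in s, e x y, y != next s x & x != next s y].

Definition chordal_extension (adj : T -> T -> Prop) : Prop :=
  [/\ ssrbool.symmetric e, irreflexive e, (forall x y, adj x y -> e x y) & chordal].

Definition clique (C : {set T}) : bool :=
  [forall x in C, forall y in C, (x != y) ==> e x y].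

Definition lists_maximal_cliques q (U : 'I_q -> {set T}) : Prop :=
  injective U /\ forall C, maxset clique C <-> exists l, U l = C.

End Graphs.

Section Reformulation.
Variables (R : realType) (n m p : nat) (f : mpoly n R) (g : 'I_m -> mpoly n R).
Variable X : 'I_p -> {set 'I_n}.

(* The variables u = (x_0, ..., x_n, w_1, ..., w_p). *)
Local Notation N := (n.+1 + p)%N.
Definition ux (i : 'I_n.+1) : 'I_N := lshift p i.
Definition uw (l : 'I_p) : 'I_N := rshift n.+1 l.
Local Notation u i := (@mvar R N i).

Definition homogenize_u (r : mpoly n R) : mpoly N R := rename ux (homogenize r).

Definition mult (i : 'I_n) : nat := #|finset (fun l => i \in X l)|.

Definition hsphere (l : 'I_p) : mpoly N R :=
  \sum_(i in X l) (mult i)%:R^-1 *: u (ux (lift ord0 i)) ^+ 2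
  + p%:R^-1 *: u (ux ord0) ^+ 2 + u (uw l) ^+ 2 - 1.

Definition hlast : mpoly N R := \sum_l u (uw l) ^+ 2 - p%:R + 1.

(* h'_{p+1} is the equation of index [ord_max]. *)
Definition hprime (j : 'I_p.+1) : mpoly N R :=
  if unlift ord_max j is Some l then hsphere l else hlast.

Definition objective (gamma : R) : mpoly N R :=
  homogenize_u f - gamma *: u (ux ord0) ^+ degree f.

Definition box (i : 'I_N) : mpoly N R := 1 - u i ^+ 2.

(* The constraint polynomials of the reformulated problem. *)
Definition constraints : seq (mpoly N R) :=
  u (ux ord0) :: codom (fun j => homogenize_u (g j)) ++ codom hprime ++ codom box.

Definition csp_adj (i j : 'I_N) : Prop :=
  i != j /\
  ((exists gamma, exists2 a, a \in msupp (objective gamma) &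
      (i \in mono_vars a) && (j \in mono_vars a))
   \/ (exists2 c, c \in constraints & (i \in vars c) && (j \in vars c))).

Section Relaxation.
Variables (q : nat) (U : 'I_q -> {set 'I_N}).
Variables (Ipart : 'I_p.+1 -> 'I_q) (Jpart : 'I_m -> 'I_q).

Definition clique_eqs (l : 'I_q) : seq (mpoly N R) :=
  [seq hprime j | j <- enum 'I_p.+1 & Ipart j == l].

Definition clique_ineqs (l : 'I_q) : seq (mpoly N R) :=
  u (ux ord0) :: [seq box i | i <- enum (U l)]
  ++ [seq homogenize_u (g j) | j <- enum 'I_m & Jpart j == l].

Definition relaxation_feasible (k : nat) (gamma : R) : Prop :=
  exists a b : 'I_q -> mpoly N R,
    [/\ forall l, in_ideal (clique_eqs l) (U l) k (a l),
        forall l, in_qmodule (clique_ineqs l) (U l) k (b l)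
      & objective gamma = \sum_l a l + \sum_l b l].

Definition f_bar (k : nat) : \bar R :=
  ereal_sup [set gamma%:E | gamma in relaxation_feasible k]%classic.

End Relaxation.
End Reformulation.

(* Main.v *)
From Pilot Require Import Defs.
From mathcomp Require Import all_boot all_order all_algebra.
From mathcomp Require Import all_classical all_reals all_analysis.
From mathcomp Require Import -(notations) mpoly.
From mathcomp Require Import fintype finset.
From mathcomp Require Import ring lra zify.
Import Order.TTheory GRing.Theory Num.Theory.
Import Pilot.Defs.
Import numFieldNormedType.Exports.
Local Open Scope ring_scope.

(** Every [f_bar k] is at most [f_min]: a feasible point [x] of the original
    problem lifts to a point [u] of the reformulation with [x_0 > 0], where a
    certificate gives [0 <= x_0 ^ d * (f x - gamma)] ([relaxation_sound]).  So
    it is enough to show that each [gamma < f_min] has a certificate of some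
    degree.

    For such a [gamma] the objective is strictly positive on the feasible set
    of the reformulation ([objective_pos]).  The equations [h'_l = 0] force
    the norm of the homogenized point to be 1; if [x_0 > 0] one dehomogenizes,
    and if [x_0 = 0] the sign is that of the top form of [f], positive by
    hypothesis.  Moreover the variables of each monomial of the objective are
    pairwise adjacent, so every monomial lives on a clique.

    It remains to prove a sparse Positivstellensatz for a chordal graph
    ([sparse_positivstellensatz]), in three steps, all of them on a large cube
    [-c, c]^N in place of the feasible set.

    - Removing the constraints.  If [p > 0] where [g >= 0], then subtracting
      [s ^ 2 * g] with [s = (1 - g / G) ^ k] and [k] large makes [p] positive
      regardless of the sign of [g] ([penalty]); here [s] only involves the
      variables of [g], so the sparsity is preserved.  An equation [h = 0] is
      treated as the inequality [- h ^ 2 >= 0], whose multiples belong to the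
      ideal of [h].

    - Splitting along the graph.  A chordal graph that is not complete has a
      clique separating it into two smaller parts ([chordal_split]).  If
      [p1 + p2 > 0] on the cube, where [p1] and [p2] live on the two parts,
      there is a polynomial [h] in the common variables with [p1 - h > 0] and
      [p2 + h > 0] on the cube ([split_pos]); since the common variables form a
      clique, both summands are again sparse.  Repeating this writes the
      polynomial as a sum of positive polynomials, each on one clique.

    - One clique.  A polynomial positive on the cube belongs to any preordering
      containing the polynomials [c + u_i] and [c - u_i]
      ([cube_positivstellensatz]).  The quadratic module of the single
      polynomial [#|V| - \sum_(i in V) u_i ^ 2] is such a preordering, because
      the square of its only generator is a sum of squares
      ([arch_ball_module]), and it is contained in the quadratic module of the
      polynomials [1 - u_i ^ 2].

    The second and the third steps freeze one variable at a time.  What holds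
    for each frozen value [a] of [u_i] is recovered for the variable itself by
    averaging over Bernstein weights in [u_i], whose variance tends to 0
    ([arch_average]). *)

(** * Polynomials in a subset of the variables *)

Section PolynomialRing.
Set Implicit Arguments.
Unset Strict Implicit.
Unset Printing Implicit Defensive.
Variables (R : realType) (n : nat).
Implicit Types (p q : mpoly n R) (V W : {set 'I_n}) (x : 'rV[R]_n).

Lemma evalD p q x : eval (p + q) x = eval p x + eval q x.
Proof. exact: mevalD. Qed.
Lemma evalB p q x : eval (p - q) x = eval p x - eval q x.
Proof. exact: mevalB. Qed.
Lemma evalN p x : eval (- p) x = - eval p x.
Proof. exact: mevalN. Qed.
Lemma evalM p q x : eval (p * q) x = eval p x * eval q x.
Proof. exact: mevalM. Qed.
Lemma evalZ (c : R) p x : eval (c *: p) x = c * eval p x.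
Proof. exact: mevalZ. Qed.
Lemma evalC (c : R) x : eval (mpolyC n c) x = c.
Proof. exact: mevalC. Qed.
Lemma eval0 x : eval (0 : mpoly n R) x = 0.
Proof. exact: meval0. Qed.
Lemma eval1 x : eval (1 : mpoly n R) x = 1.
Proof. exact: meval1. Qed.
Lemma eval_mvar i x : eval (mvar R i) x = x ord0 i.
Proof. exact: mevalXU. Qed.
Lemma evalX p k x : eval (p ^+ k) x = eval p x ^+ k.
Proof. exact: (rmorphXn (meval _)). Qed.
Lemma eval_sum I (r : seq I) (P : pred I) (F : I -> mpoly n R) x :
  eval (\sum_(i <- r | P i) F i) x = \sum_(i <- r | P i) eval (F i) x.
Proof. exact: (raddf_sum (meval _)). Qed.
Lemma eval_prod I (r : seq I) (P : pred I) (F : I -> mpoly n R) x :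
  eval (\prod_(i <- r | P i) F i) x = \prod_(i <- r | P i) eval (F i) x.
Proof. exact: (rmorph_prod (meval _)). Qed.
Definition evalE := (evalD, evalB, evalN, evalM, evalZ, evalC, eval0, eval1,
  eval_mvar, evalX, eval_sum, eval_prod).

Lemma in_polyringP V p :
  in_polyring V p <-> forall a, a \in msupp p -> mono_vars a \subset V.
Proof.
rewrite /in_polyring /vars; elim: (msupp p) => [|b s IH].
  by rewrite big_nil sub0set; split.
rewrite big_cons subUset; split.
  move=> /andP[bV sV] a; rewrite inE => /orP[/eqP->//|as_].
  by apply: (proj1 IH sV).
move=> H; apply/andP; split; first by apply: H; rewrite inE eqxx.
by apply/IH => a as_; apply: H; rewrite inE as_ orbT.
Qed.

Lemma in_polyringS V W p : V \subset W -> in_polyring V p -> in_polyring W p.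
Proof. by move=> VW pV; exact: subset_trans VW. Qed.

Lemma in_polyringT p : in_polyring [set: 'I_n] p.
Proof. exact: subsetT. Qed.

Lemma in_polyringD V p q :
  in_polyring V p -> in_polyring V q -> in_polyring V (p + q).
Proof.
move=> /in_polyringP pV /in_polyringP qV; apply/in_polyringP => a.
by move/msuppD_le; rewrite mem_cat => /orP[/pV|/qV].
Qed.

Lemma in_polyringN V p : in_polyring V p -> in_polyring V (- p).
Proof.
by move=> /in_polyringP pV; apply/in_polyringP => a; rewrite (perm_mem (msuppN p)) => /pV.
Qed.

Lemma mono_varsD (a b : multinom n) :
  mono_vars (mnm_add a b) \subset mono_vars a :|: mono_vars b.
Proof.
apply/subsetP => i; rewrite !inE mnmDE => H.
by case: eqP => //= a0; move: H; rewrite a0 add0n => ->.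
Qed.

Lemma in_polyringM V p q :
  in_polyring V p -> in_polyring V q -> in_polyring V (p * q).
Proof.
move=> /in_polyringP pV /in_polyringP qV; apply/in_polyringP => a.
move/msuppM_le/allpairsP => [[b c] /= [/pV bV /qV cV ->]].
by apply: subset_trans (mono_varsD _ _) _; rewrite subUset bV.
Qed.

Lemma in_polyringC V (c : R) : in_polyring V (mpolyC n c).
Proof.
apply/in_polyringP => a; rewrite msuppC; case: eqP => // _.
rewrite inE => /eqP ->; apply/subsetP => i; by rewrite inE mnm0E eqxx.
Qed.

Lemma in_polyring0 V : in_polyring V (0 : mpoly n R).
Proof. by rewrite -(mpolyC0 n); exact: in_polyringC. Qed.

Lemma in_polyring1 V : in_polyring V (1 : mpoly n R).
Proof. by rewrite -(mpolyC1 n); exact: in_polyringC. Qed.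

Lemma in_polyringB V p q :
  in_polyring V p -> in_polyring V q -> in_polyring V (p - q).
Proof. by move=> pV qV; apply/in_polyringD/in_polyringN. Qed.

Lemma in_polyringX V p k : in_polyring V p -> in_polyring V (p ^+ k).
Proof.
move=> pV; elim: k => [|k IH]; first by rewrite expr0; exact: in_polyring1.
by rewrite exprS; exact: in_polyringM.
Qed.

Lemma in_polyring_sum V I (r : seq I) (P : pred I) (F : I -> mpoly n R) :
  (forall i, P i -> in_polyring V (F i)) -> in_polyring V (\sum_(i <- r | P i) F i).
Proof.
by move=> H; elim/big_ind: _ => //; [exact: in_polyring0|exact: in_polyringD].
Qed.

Lemma in_polyring_mvar V i : i \in V -> in_polyring V (mvar R i).
Proof.
move=> iV; apply/in_polyringP => a; rewrite msuppX inE => /eqP ->.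
apply/subsetP => j; rewrite inE mnm1E; by case: (eqVneq i j) => [<-|].
Qed.

(** Substitution, continuity and boundedness are compatible with sums and
    products, so it is enough to check them on constants and variables. *)
Lemma polyring_ind V (P : mpoly n R -> Prop) :
  (forall c : R, P (mpolyC n c)) ->
  (forall i, i \in V -> P (mvar R i)) ->
  (forall p q, P p -> P q -> P (p + q)) ->
  (forall p q, P p -> P q -> P (p * q)) ->
  forall p, in_polyring V p -> P p.
Proof.
move=> PC PX PD PM p /in_polyringP pV; rewrite [p]mpolyE.
have P0 : P 0 by rewrite -(mpolyC0 n).
have P1 : P 1 by rewrite -(mpolyC1 n).
rewrite big_seq; apply: (big_ind P) => // a /pV/subsetP aV.
rewrite -mul_mpolyC; apply: (PM) => //; rewrite mpolyXE_id.
apply: (big_ind P P1 PM) => i _; case: (posnP (a i)) => [->|ai0].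
  by rewrite expr0.
have Pi : P (mvar R i) by apply/PX/aV; rewrite inE -lt0n.
elim: (a i) => [|k IH]; first by rewrite expr0.
by rewrite exprS; apply: (PM).
Qed.

Definition specialize (i : 'I_n) (a : R) : mpoly n R -> mpoly n R :=
  mmap (@mpolyC n R) (fun j => if j == i then mpolyC n a else mvar R j).

Definition update x (i : 'I_n) (a : R) : 'rV[R]_n :=
  \row_j (if j == i then a else x ord0 j).

Lemma specializeD i a p q :
  specialize i a (p + q) = specialize i a p + specialize i a q.
Proof. exact: (rmorphD (mmap _ _)). Qed.
Lemma specializeM i a p q :
  specialize i a (p * q) = specialize i a p * specialize i a q.
Proof. exact: (rmorphM (mmap _ _)). Qed.
Lemma specializeC i a (c : R) : specialize i a (mpolyC n c) = mpolyC n c.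
Proof. exact: mmapC. Qed.
Lemma specialize_mvar i a j :
  specialize i a (mvar R j) = if j == i then mpolyC n a else mvar R j.
Proof. by rewrite /specialize /mvar mmapX mmap1U. Qed.

Lemma in_polyring_specialize V i a p :
  in_polyring V p -> in_polyring (V :\ i) (specialize i a p).
Proof.
move: p; apply: polyring_ind => [c|j jV|p q|p q].
- by rewrite specializeC; exact: in_polyringC.
- rewrite specialize_mvar; case: eqP => ji; first exact: in_polyringC.
  by apply: in_polyring_mvar; rewrite !inE jV andbT; apply/eqP.
- by rewrite specializeD; exact: in_polyringD.
- by rewrite specializeM; exact: in_polyringM.
Qed.

Lemma eval_specialize i a p x : eval (specialize i a p) x = eval p (update x i a).
Proof.
move: p (in_polyringT p); apply: polyring_ind => [c|j _|p q|p q].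
- by rewrite specializeC !evalE.
- by rewrite specialize_mvar !evalE mxE; case: eqP => // _; rewrite evalE.
- by rewrite specializeD !evalE => -> ->.
- by rewrite specializeM !evalE => -> ->.
Qed.

Lemma eval_ext V p (x y : 'rV[R]_n) : in_polyring V p ->
  (forall i, i \in V -> x ord0 i = y ord0 i) -> eval p x = eval p y.
Proof.
move=> + xy; move: p; apply: polyring_ind => [c|j jV|p q|p q]; rewrite !evalE //.
- exact: xy.
- by move=> -> ->.
- by move=> -> ->.
Qed.

Lemma eval_continuous p : continuous (eval p : 'rV[R]_n -> R).
Proof.
move: p (in_polyringT p); apply: polyring_ind => [c|j _|p q pc qc|p q pc qc] x.
- rewrite (_ : eval _ = fun=> c); first exact: cst_continuous.
  by apply/funext => y; rewrite evalE.
- rewrite (_ : eval _ = fun y : 'rV[R]_n => y ord0 j); first exact: coord_continuous.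
  by apply/funext => y; rewrite evalE.
- rewrite (_ : eval _ = fun y => eval p y + eval q y).
    exact: (continuousD (pc x) (qc x)).
  by apply/funext => y; rewrite evalE.
- rewrite (_ : eval _ = fun y => eval p y * eval q y).
    exact: (continuousM (pc x) (qc x)).
  by apply/funext => y; rewrite evalE.
Qed.

Definition cube (c : R) : set 'rV[R]_n :=
  [set x | forall i, - c <= x ord0 i <= c]%classic.

Lemma cube_compact c : compact (cube c).
Proof.
rewrite (_ : cube c = [set x | forall i, `[- c, c]%classic (x ord0 i)]%classic).
  by apply: (@rV_compact R n (fun=> `[- c, c]%classic)) => i; exact: segment_compact.
by apply/seteqP; split => x Hx i; have := Hx i; rewrite /= in_itv.
Qed.

Lemma closed_eval_ge0 p : closed [set x | 0 <= eval p x]%classic.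
Proof.
rewrite (_ : [set x | _]%classic = eval p @^-1` [set y | 0 <= y]%classic)%classic //.
by apply: closed_comp => [x _|]; [exact: eval_continuous|exact: closed_ge].
Qed.

Lemma compact_min (C : set 'rV[R]_n) (h : 'rV[R]_n -> R) :
  (C !=set0)%classic -> compact C -> continuous h ->
  exists2 x, C x & forall y, C y -> h x <= h y.
Proof.
move=> C0 Cc hc.
have [x xC xmin] := compact_EVT_min C0 Cc (continuous_subspaceT hc).
by exists x; [exact: set_mem|move=> y Cy; apply: xmin; exact: mem_set].
Qed.

Lemma compact_pos_bound (C : set 'rV[R]_n) (h : 'rV[R]_n -> R) :
  compact C -> continuous h -> (forall x, C x -> 0 < h x) ->
  exists2 e : R, 0 < e & forall x, C x -> e <= h x.
Proof.
move=> Cc hc hpos; have [C0|C0] := pselect (C !=set0)%classic.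
  by have [x Cx xmin] := compact_min C0 Cc hc; exists (h x) => //; exact: hpos.
by exists 1 => // x Cx; case: C0; exists x.
Qed.

Lemma compact_eval_bound (C : set 'rV[R]_n) p :
  compact C -> exists2 B : R, 0 < B & forall x, C x -> `|eval p x| <= B.
Proof.
move=> Cc; have [C0|C0] := pselect (C !=set0)%classic; last first.
  by exists 1 => // x Cx; case: C0; exists x.
have [x Cx xmin] := compact_min C0 Cc (eval_continuous (p := - p ^+ 2)).
exists (1 + eval p x ^+ 2) => [|y /xmin].
  by rewrite ltr_pwDl // sqr_ge0.
rewrite !evalE lerN2 => yx; apply: le_trans (_ : 1 + eval p y ^+ 2 <= _).
  by have := sqr_ge0 (`|eval p y| - 1); rewrite -(real_normK (num_real (eval p y))); nra.
by rewrite lerD2l.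
Qed.

End PolynomialRing.

(** * Positivity on a cube *)

Section Averaging.
Variable A : comNzRingType.

(** Think of [t] as a probability.  A walk starting at [d - m * t] makes [m]
    independent steps, of length 1 with probability [t] and 0 otherwise; it has
    mean [d] and variance [m * t * (1 - t)] when it stops, and the hypothesis
    speaks of its final positions.  Conditioning on the first step turns this
    computation of a Bernstein sum into an induction that never writes the
    weights. *)
Lemma random_walk_average (Q : A -> Prop) (t k : A) :
  (forall y z, Q y -> Q z -> Q (t * y + (1 - t) * z)) ->
  forall (m : nat) (d : A),
    (forall a, (a <= m)%N -> Q (k * (d + a%:R - m%:R * t) ^+ 2)) ->
    Q (k * (d ^+ 2 + m%:R * (t * (1 - t)))).
Proof.
move=> mix; elim=> [|m IH] d H.
  by have := H 0%N isT; congr Q; ring.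
have Q1 : Q (k * ((d + 1 - t) ^+ 2 + m%:R * (t * (1 - t)))).
  by apply: IH => a am; have := H a.+1 am; congr Q; rewrite -(natr1 a) -(natr1 m); ring.
have Q2 : Q (k * ((d - t) ^+ 2 + m%:R * (t * (1 - t)))).
  by apply: IH => a am; have := H a (leqW am); congr Q; rewrite -(natr1 m); ring.
by have := mix _ _ Q1 Q2; congr Q; rewrite -(natr1 m); ring.
Qed.

End Averaging.

Section Preorderings.
Set Implicit Arguments.
Unset Strict Implicit.
Unset Printing Implicit Defensive.
Variables (R : realType) (n : nat).
Implicit Types (p q : mpoly n R) (V W : {set 'I_n}) (x : 'rV[R]_n).
Local Notation cst := (@mpolyC n R).
Local Notation X i := (mvar R i).

(** The polynomials of [M] count as positive.  There are two uses: [M] is a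
    quadratic module, or the set of polynomials nonnegative on the cube. *)
Record arch_preordering (c : R) V (M : mpoly n R -> Prop) : Prop :=
  ArchPreordering {
    arch_add : forall p q, M p -> M q -> M (p + q);
    arch_mul : forall p q, M p -> M q -> M (p * q);
    arch_sqr : forall p, in_polyring V p -> M (p ^+ 2);
    arch_lo : forall i, i \in V -> M (cst c + X i);
    arch_hi : forall i, i \in V -> M (cst c - X i) }.

Section Theory.
Variables (c : R) (V : {set 'I_n}) (M : mpoly n R -> Prop).
Hypotheses (c_gt0 : 0 < c) (MP : arch_preordering c V M).

Lemma arch_cst (a : R) : 0 <= a -> M (cst a).
Proof.
move=> a0; have := arch_sqr MP (in_polyringC V (Num.sqrt a)).
by rewrite -rmorphXn /= sqr_sqrtr.
Qed.

Lemma arch_scale (a : R) p : 0 <= a -> M p -> M (cst a * p).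
Proof. by move=> a0; apply: (arch_mul MP); exact: arch_cst. Qed.

(** The weights [t] and [1 - t] sum to 1 and are positive on the cube.  With
    the points [a = - c + 2 * c * j / m], the average of [C * (X i - a) ^ 2] is
    [C / m * (c ^ 2 - X i ^ 2)], which is below [e] for large [m].  The
    constant [C] has to be the same for all [a], since the points depend on
    [m]. *)
Lemma arch_average (Q : mpoly n R -> Prop) (i : 'I_n) (C e : R) :
  i \in V -> 0 <= C -> 0 < e ->
  let t := cst (2 * c)^-1 * (cst c + X i) in
  (forall y z, Q y -> Q z -> Q (t * y + (1 - t) * z)) ->
  (forall y z, Q y -> M z -> Q (y + z)) ->
  (forall a, - c <= a <= c -> Q (cst C * (X i - cst a) ^+ 2)) ->
  Q (cst e).
Proof.
move=> iV C0 e0 t mix up H.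
have [m mC] : exists m : nat, C * c ^+ 2 / e <= m.+1%:R.
  exists (Num.truncn (C * c ^+ 2 / e)).
  by rewrite ltW // truncnS_gt.
have c0 : c != 0 by rewrite gt_eqF.
have m0 : (m.+1%:R : R) != 0 by rewrite pnatr_eq0.
have ct : cst (2 * c) * t = cst c + X i.
  by rewrite /t mulrA -rmorphM /= mulfV ?mul1r // mulf_neq0 // pnatr_eq0.
pose k := C * (2 * c) ^+ 2 / m.+1%:R ^+ 2.
have kE : cst C * cst (2 * c) ^+ 2 = cst k * m.+1%:R ^+ 2.
  rewrite -(rmorph_nat cst) -!rmorphXn -!rmorphM /=; congr cst.
  by rewrite /k; field.
have : Q (cst k * (0 ^+ 2 + m.+1%:R * (t * (1 - t)))).
  apply: random_walk_average => // a am.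
  have ale : - c <= - c + 2 * c * (a%:R / m.+1%:R) <= c.
    have /andP[z0 z1] : 0 <= (a%:R / m.+1%:R : R) <= 1.
      by rewrite divr_ge0 // ler_pdivrMr ?ltr0n // mul1r ler_nat.
    move: (a%:R / _) z0 z1 => z z0 z1.
    have := mulr_ge0 (ltW c_gt0) z0; have := ler_wpM2l (ltW c_gt0) z1.
    by rewrite mulr1 => ? ?; apply/andP; split; lra.
  have := H _ ale; congr Q; rewrite add0r.
  have -> : X i - cst (- c + 2 * c * (a%:R / m.+1%:R)) =
      cst (2 * c) * (t - cst (a%:R / m.+1%:R)).
    by rewrite mulrBr ct -rmorphM /= rmorphD rmorphN /=; ring.
  rewrite exprMn mulrA kE -mulrA -exprMn -[in RHS]sqrrN opprB; congr (_ * _ ^+ 2).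
  rewrite mulrBr -(rmorph_nat cst m.+1) -rmorphM /= [m.+1%:R * _]mulrC divfK //.
  by rewrite !rmorph_nat.
move=> Qk.
have : Q (cst (C / m.+1%:R) * (cst (c ^+ 2) - X i ^+ 2)).
  have cc : cst (2 * c) * (1 - t) = cst c - X i.
    by rewrite mulrBr ct mulr1 rmorphM /= rmorph_nat; ring.
  move: Qk; congr Q; rewrite expr0n add0r.
  have -> : cst k = cst (C / m.+1%:R) * cst (m.+1%:R^-1) * cst (2 * c) ^+ 2.
    by rewrite -!rmorphXn -!rmorphM /=; congr cst; rewrite /k; field.
  have mm : cst (m.+1%:R^-1) * m.+1%:R = 1.
    by rewrite -(rmorph_nat cst) -rmorphM /= mulVf.
  transitivity (cst (C / m.+1%:R) * (cst (m.+1%:R^-1) * m.+1%:R) *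
     ((cst (2 * c) * t) * (cst (2 * c) * (1 - t)))); first by ring.
  by rewrite mm ct cc rmorphXn /=; ring.
move=> /up up'.
have Mr : M (cst (e - C / m.+1%:R * c ^+ 2) + cst (C / m.+1%:R) * X i ^+ 2).
  apply: (arch_add MP).
    apply: arch_cst; rewrite subr_ge0.
    move: mC; rewrite ler_pdivrMr // => mC.
    by rewrite mulrAC ler_pdivrMr ?ltr0n // [leRHS]mulrC.
  apply: arch_scale; first by rewrite divr_ge0.
  by apply: (arch_sqr MP); exact: in_polyring_mvar.
have := up' _ Mr; congr Q; rewrite rmorphB rmorphM /=; ring.
Qed.

(** This bounds [p] by the square root of [B] for the order defined by [M], in
    a form that is stable under sums and products. *)
Definition arch_bounded (B : R) p :=
  [/\ 0 <= B, in_polyring V p & M (cst B - p ^+ 2)].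

Lemma arch_bounded_cst (a B : R) : a ^+ 2 <= B -> arch_bounded B (cst a).
Proof.
move=> aB; split; [exact: le_trans (sqr_ge0 a) aB|exact: in_polyringC|].
by rewrite -rmorphXn -rmorphB /=; apply: arch_cst; rewrite subr_ge0.
Qed.

Lemma arch_bounded_mvar i : i \in V -> arch_bounded (c ^+ 2) (X i).
Proof.
move=> iV; split; [exact: sqr_ge0|exact: in_polyring_mvar|].
rewrite rmorphXn /= subr_sqr; apply: (arch_mul MP); first exact: (arch_hi MP).
exact: (arch_lo MP).
Qed.

Lemma arch_boundedD B B' p q : arch_bounded B p -> arch_bounded B' q ->
  arch_bounded (2 * B + 2 * B') (p + q).
Proof.
move=> [B0 pV pB] [B0' qV qB]; split; first by nra.
  exact: in_polyringD.
have H : M (cst 2 * (cst B - p ^+ 2) + cst 2 * (cst B' - q ^+ 2) + (p - q) ^+ 2).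
  by do ![apply: (arch_add MP)|exact: arch_scale|
          exact: (arch_sqr MP) (in_polyringB pV qV)].
by move: H; congr M; ring.
Qed.

Lemma arch_boundedM B B' p q : arch_bounded B p -> arch_bounded B' q ->
  arch_bounded (B * B') (p * q).
Proof.
move=> [B0 pV pB] [B0' qV qB]; split; [exact: mulr_ge0|exact: in_polyringM|].
have H : M (cst B' * (cst B - p ^+ 2) + p ^+ 2 * (cst B' - q ^+ 2)).
  apply: (arch_add MP); first exact: arch_scale.
  by apply: (arch_mul MP) => //; exact: (arch_sqr MP).
by move: H; congr M; rewrite rmorphM /=; ring.
Qed.

(** The factor theorem, with a quotient bounded uniformly in [a].  The bounds
    on [p] and on its specialization are carried along for the product case,
    where the quotient is [q * r + p(a) * q']. *)
Lemma arch_increment i p : i \in V -> in_polyring V p ->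
  exists B B' B'', forall a, - c <= a <= c -> exists q,
    [/\ p - specialize i a p = (X i - cst a) * q, arch_bounded B q,
        arch_bounded B' p & arch_bounded B'' (specialize i a p)].
Proof.
move=> iV; move: p; apply: polyring_ind => [b|j jV|p r|p r].
- exists 0, (b ^+ 2), (b ^+ 2) => a _; exists 0.
  rewrite specializeC subrr mulr0; split => //; try exact: arch_bounded_cst.
  by rewrite -(mpolyC0 n); apply: arch_bounded_cst; rewrite expr0n.
- exists 1, (c ^+ 2), (c ^+ 2) => a ac; rewrite specialize_mvar.
  have [->|ji] := eqVneq j i.
    exists 1; rewrite mulr1; split => //.
    + by rewrite -(mpolyC1 n); apply: arch_bounded_cst; rewrite expr1n.
    + exact: arch_bounded_mvar.
    + by apply: arch_bounded_cst; nra.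
  exists 0; rewrite subrr mulr0; split => //; try exact: arch_bounded_mvar.
  by rewrite -(mpolyC0 n); apply: arch_bounded_cst; rewrite expr0n ler01.
- move=> [B1 [B2 [B3 H]]] [D1 [D2 [D3 H']]].
  exists (2 * B1 + 2 * D1), (2 * B2 + 2 * D2), (2 * B3 + 2 * D3) => a ac; have [q [qE q1 q2 q3]] := H a ac.
  have [q' [qE' q1' q2' q3']] := H' a ac.
  exists (q + q'); rewrite specializeD; split; try exact: arch_boundedD.
  by rewrite mulrDr -qE -qE'; ring.
- move=> [B1 [B2 [B3 H]]] [D1 [D2 [D3 H']]].
  exists (2 * (B1 * D2) + 2 * (B3 * D1)), (B2 * D2), (B3 * D3) => a ac; have [q [qE q1 q2 q3]] := H a ac.
  have [q' [qE' q1' q2' q3']] := H' a ac.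
  exists (q * r + specialize i a p * q'); rewrite specializeM; split; try exact: arch_boundedM.
    transitivity (((X i - cst a) * q) * r + specialize i a p * ((X i - cst a) * q')).
      by rewrite -qE -qE'; ring.
    by ring.
  by apply: arch_boundedD; exact: arch_boundedM.
Qed.

(** Completing the square: with [2 * k' * k = 1], the increment [d * q] is
    [(k' * d + k * q) ^ 2 - k' ^ 2 * d ^ 2 - k ^ 2 * q ^ 2], and the bound on
    [q] makes [k ^ 2 * q ^ 2] at most [e] for a suitable [k]. *)
Lemma arch_taylor i p (e : R) : i \in V -> in_polyring V p -> 0 < e ->
  exists2 C, 0 <= C & forall a, - c <= a <= c ->
    M (p - specialize i a p + cst e + cst C * (X i - cst a) ^+ 2).
Proof.
move=> iV pV e0; have [B [B' [B'' H]]] := arch_increment iV pV.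
have [B0|B0] := leP 0 B; last first.
  exists 0 => // a /H[q [_ [+ _ _] _ _]]; by rewrite leNgt B0.
pose k := Num.sqrt (e / (B + 1)).
have k2 : k ^+ 2 = e / (B + 1).
  by rewrite sqr_sqrtr // divr_ge0 // ltW // ltr_wpDl.
have k0 : 0 < k by rewrite sqrtr_gt0 divr_gt0 // ltr_wpDl.
exists ((2 * k)^-1 ^+ 2) => [|a /H[q [-> [_ qV qB] _ _]]]; first exact: sqr_ge0.
have Hk : 2 * cst (2 * k)^-1 * cst k = 1.
  rewrite -[2](rmorph_nat cst) -!rmorphM /= -[RHS](rmorph1 cst); congr cst.
  by field; rewrite gt_eqF.
have XV : in_polyring V (cst (2 * k)^-1 * (X i - cst a) + cst k * q).
  apply: in_polyringD; apply: in_polyringM => //; try exact: in_polyringC.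
  by apply: in_polyringB; [exact: in_polyring_mvar|exact: in_polyringC].
have S : M ((cst (2 * k)^-1 * (X i - cst a) + cst k * q) ^+ 2
   + (cst (k ^+ 2) * (cst B - q ^+ 2) + cst (e - k ^+ 2 * B))).
  apply: (arch_add MP); first exact: (arch_sqr MP).
  apply: (arch_add MP); first by apply: arch_scale => //; exact: sqr_ge0.
  apply: arch_cst; rewrite subr_ge0 k2 mulrAC ler_pdivrMr; last by rewrite ltr_wpDl.
  by rewrite ler_wpM2l // ?(ltW e0) // lerDl.
move: S; congr M; rewrite rmorphB rmorphM /= !rmorphXn /=.
set K := cst (2 * k)^-1 in Hk *; set K' := cst k in Hk *.
transitivity ((2 * K * K') * ((X i - cst a) * q) + cst e + K ^+ 2 * (X i - cst a) ^+ 2).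
  by ring.
by rewrite Hk mul1r.
Qed.

Lemma in_cube_update x i a : cube c x -> - c <= a <= c -> cube c (update x i a).
Proof. by move=> xc ac j; rewrite mxE; case: ifP. Qed.

Lemma cube0 : cube c (0 : 'rV[R]_n).
Proof. by move=> j; rewrite mxE; apply/andP; split; rewrite ?oppr_le0 ltW. Qed.

Lemma polyring_set0 p : in_polyring set0 p -> p = cst (eval p 0).
Proof.
move: p; apply: polyring_ind => [b|j|p q|p q]; rewrite ?evalE //.
- by rewrite inE.
- by rewrite rmorphD /= => <- <-.
- by rewrite rmorphM /= => <- <-.
Qed.

(** Induction on the set [W] of variables of [p].  Specializing one variable
    to [a] leaves a positive polynomial in fewer variables, and [arch_taylor]
    compares [p] with it up to [e + C * (X i - a) ^ 2], an error whose quadratic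
    part is absorbed by [arch_average]. *)
Theorem cube_positivstellensatz p : in_polyring V p ->
  (forall x, cube c x -> 0 < eval p x) -> M p.
Proof.
have [k] := ubnP #|V|; have := subxx V; move: {1 3 4}V => W.
elim: k W p => // k IH W p WV; rewrite ltnS => Wk pW ppos.
have [W0|[i iW]] := set_0Vmem W.
  by rewrite W0 in pW; rewrite (polyring_set0 pW); apply/arch_cst/ltW/ppos/cube0.
have iV : i \in V by exact: (subsetP WV).
have [e' e0 ple] := compact_pos_bound (cube_compact (n := n) (c := c)) (@eval_continuous _ _ p) ppos.
pose e := e' / 3.
have {}e0 : 0 < e by rewrite divr_gt0.
have [C C0 taylor] := arch_taylor iV (in_polyringS WV pW) e0.
suff : M (p - cst e + cst e) by rewrite subrK.
apply: (arch_average (Q := fun y => M (p - cst e + y)) iV C0 e0).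
- set t := cst _ * _ => y z My Mz.
  suff : M (t * (p - cst e + y) + (1 - t) * (p - cst e + z)) by congr M; ring.
  apply: (arch_add MP); apply: (arch_mul MP) => //.
    by apply: arch_scale; [rewrite invr_ge0 mulr_ge0 // ltW|exact: (arch_lo MP)].
  have -> : 1 - t = cst (2 * c)^-1 * (cst c - X i).
    have H : cst (2 * c)^-1 * cst (2 * c) = 1.
      by rewrite -rmorphM /= mulVf ?rmorph1 // mulf_neq0 // ?pnatr_eq0 // gt_eqF.
    rewrite /t -[1]H rmorphM /= rmorph_nat; ring.
  by apply: arch_scale; [rewrite invr_ge0 mulr_ge0 // ltW|exact: (arch_hi MP)].
- by move=> y z My Mz; rewrite addrA; exact: (arch_add MP).
move=> a ac.
suff Ms : M (specialize i a p - cst (2 * e)).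
  have := arch_add MP Ms (taylor a ac); congr M.
  by rewrite rmorphM /= rmorph_nat; ring.
apply: (IH (W :\ i)).
- exact: subset_trans (subsetDl _ _) WV.
- by move: Wk; rewrite (cardsD1 i) iW.
- by apply: in_polyringB; [exact: in_polyring_specialize|exact: in_polyringC].
move=> x xc; rewrite evalB eval_specialize evalC.
have := ple _ (in_cube_update i xc ac); have : e' = 3 * e by rewrite /e; field.
by lra.
Qed.

End Theory.

Lemma arch_nonneg_cube (c : R) : 0 <= c ->
  arch_preordering c [set: 'I_n] (fun p => forall x, cube c x -> 0 <= eval p x).
Proof.
move=> c0; split.
- by move=> p q Mp Mq x xc; rewrite evalE addr_ge0 ?Mp ?Mq.
- by move=> p q Mp Mq x xc; rewrite evalE mulr_ge0 ?Mp ?Mq.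
- by move=> p _ x _; rewrite evalE sqr_ge0.
- by move=> i _ x /(_ i); rewrite !evalE; lra.
- by move=> i _ x /(_ i); rewrite !evalE; lra.
Qed.

End Preorderings.

(** * Splitting a positive sum *)

Section Splitting.
Set Implicit Arguments.
Unset Strict Implicit.
Unset Printing Implicit Defensive.
Variables (R : realType) (n : nat) (c : R).
Hypothesis c_gt0 : 0 < c.
Implicit Types (p q : mpoly n R) (V S : {set 'I_n}) (x : 'rV[R]_n).
Local Notation cst := (@mpolyC n R).
Local Notation X i := (mvar R i).

Let nonneg p := forall x, cube c x -> 0 <= eval p x.

(** Induction on the set [S] of common variables.  Without common variables the
    minima of [p1] and [p2] are attained at one point, and [h] is the minimum of
    [p1].  Otherwise, specializing a common variable to [a] gives a polynomial
    [h] that depends on [a], and averaging these polynomials with Bernstein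
    weights in that variable gives [h] itself. *)
Lemma split_nonneg S V1 V2 p1 p2 : V1 :&: V2 \subset S ->
  in_polyring V1 p1 -> in_polyring V2 p2 ->
  (forall x, cube c x -> 0 < eval (p1 + p2) x) ->
  exists2 h, in_polyring S h & nonneg (p1 - h) /\ nonneg (p2 + h).
Proof.
have [k] := ubnP #|S|.
elim: k S V1 V2 p1 p2 => // k IH S V1 V2 p1 p2; rewrite ltnS => Sk V12 pV1 pV2 ppos.
have cube0n : (cube (n := n) c !=set0)%classic by exists 0; exact: cube0.
have ccube := cube_compact (n := n) (c := c).
have [S0|[i iS]] := set_0Vmem S.
  have [x1 cx1 min1] := compact_min cube0n ccube (@eval_continuous _ _ p1).
  have [x2 cx2 min2] := compact_min cube0n ccube (@eval_continuous _ _ p2).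
  exists (cst (eval p1 x1)); first exact: in_polyringC.
  split=> x cx; rewrite !evalE; first by rewrite subr_ge0; exact: min1.
  pose z : 'rV[R]_n := \row_j (if j \in V1 then x1 ord0 j else x2 ord0 j).
  have cz : cube c z by move=> j; rewrite mxE; case: ifP.
  have z1 : eval p1 z = eval p1 x1.
    by apply: (eval_ext pV1) => j jV1; rewrite mxE jV1.
  have z2 : eval p2 z = eval p2 x2.
    apply: (eval_ext pV2) => j jV2; rewrite mxE; case: ifP => // jV1.
    by have := subsetP V12 j; rewrite S0 !inE jV1 jV2 => /(_ isT).
  have := ppos z cz; have := min2 x cx; rewrite evalE z1 z2; lra.
have [e' e0 ple] := compact_pos_bound ccube (@eval_continuous _ _ (p1 + p2)) ppos.
pose e := e' / 5.
have {}e0 : 0 < e by rewrite divr_gt0.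
(* For each of [p1] and [p2], [arch_taylor] costs [e] and the final average
   another [e]; the fifth [e] keeps the specialized sum positive. *)
have e'E : e' = 5 * e by rewrite /e; field.
have MP := arch_nonneg_cube n (ltW c_gt0).
have [C1 C10 taylor1] := arch_taylor MP (in_setT i) (in_polyringT p1) e0.
have [C2 C20 taylor2] := arch_taylor MP (in_setT i) (in_polyringT p2) e0.
pose Q y := exists2 h, in_polyring S h &
  nonneg (p1 - cst e + y - h) /\ nonneg (p2 - cst e + y + h).
suff [h hS [h1 h2]] : Q (cst e).
  exists h => //; split; first by move: h1; rewrite subrK.
  by move: h2; rewrite subrK.
apply: (arch_average c_gt0 MP (Q := Q) (in_setT i) (addr_ge0 C10 C20) e0).
- set t := cst _ * _ => y z [h hS [h1 h2]] [h' hS' [h1' h2']].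
  exists (t * h + (1 - t) * h').
    have tS : in_polyring S t.
      apply: in_polyringM; first exact: in_polyringC.
      by apply: in_polyringD; [exact: in_polyringC|exact: in_polyring_mvar].
    apply: in_polyringD; apply: in_polyringM => //.
    by apply: in_polyringB => //; exact: in_polyring1.
  have t01 x : cube c x -> 0 <= eval t x <= 1.
    move=> /(_ i) xi; rewrite /t !evalE mulrC ler_pdivlMr ?mulr_gt0 //.
    by rewrite ler_pdivrMr ?mulr_gt0 //; apply/andP; split; lra.
  clearbody t; split=> x cx; have /andP[t0] := t01 x cx; rewrite -subr_ge0 => t1.
    have := addr_ge0 (mulr_ge0 t0 (h1 x cx)) (mulr_ge0 t1 (h1' x cx)).
    by rewrite !(evalD, evalN, evalM, eval1); lra.
  have := addr_ge0 (mulr_ge0 t0 (h2 x cx)) (mulr_ge0 t1 (h2' x cx)).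
  by rewrite !(evalD, evalN, evalM, eval1); lra.
- move=> y z [h hS [h1 h2]] Mz; exists h => //; split=> x cx.
    by have := h1 x cx; have := Mz x cx; rewrite !evalE; lra.
  by have := h2 x cx; have := Mz x cx; rewrite !evalE; lra.
move=> a ac.
have [] := IH (S :\ i) (V1 :\ i) (V2 :\ i)
    (specialize i a p1 - cst (2 * e)) (specialize i a p2 - cst (2 * e)).
- by move: Sk; rewrite (cardsD1 i) iS.
- apply/subsetP => j; rewrite !inE => /andP[/andP[-> j1] /andP[_ j2]] /=.
  by apply: (subsetP V12); rewrite inE j1.
- by apply: in_polyringB; [exact: in_polyring_specialize|exact: in_polyringC].
- by apply: in_polyringB; [exact: in_polyring_specialize|exact: in_polyringC].
- move=> x cx; rewrite evalD !evalB !eval_specialize evalC.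
  have := ple _ (in_cube_update i cx ac); rewrite evalD; lra.
move=> h hS [h1 h2]; exists h; first by exact: in_polyringS (subsetDl _ _) hS.
split=> x cx.
  have := h1 x cx; have := taylor1 a ac x cx.
  have := mulr_ge0 C20 (sqr_ge0 (x ord0 i - a)).
  by rewrite !(evalD, evalB, evalN) eval_specialize !evalE; lra.
have := h2 x cx; have := taylor2 a ac x cx.
have := mulr_ge0 C10 (sqr_ge0 (x ord0 i - a)).
by rewrite !(evalD, evalB, evalN) eval_specialize !evalE; lra.
Qed.

Lemma split_pos V1 V2 p1 p2 :
  in_polyring V1 p1 -> in_polyring V2 p2 ->
  (forall x, cube c x -> 0 < eval (p1 + p2) x) ->
  exists2 h, in_polyring (V1 :&: V2) h &
    (forall x, cube c x -> 0 < eval (p1 - h) x) /\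
    (forall x, cube c x -> 0 < eval (p2 + h) x).
Proof.
move=> pV1 pV2 ppos.
have [e e0 ple] := compact_pos_bound (cube_compact (n := n) (c := c))
  (@eval_continuous _ _ (p1 + p2)) ppos.
have [||x cx|h hS [h1 h2]] := split_nonneg (S := V1 :&: V2) (V1 := V1) (V2 := V2)
    (p1 := p1 - cst (e / 3)) (p2 := p2 - cst (e / 3)) (subxx _).
- by apply: in_polyringB => //; exact: in_polyringC.
- by apply: in_polyringB => //; exact: in_polyringC.
- by have := ple x cx; rewrite !evalE; lra.
exists h => //; split=> x cx.
  by have := h1 x cx; rewrite !evalE; lra.
by have := h2 x cx; rewrite !evalE; lra.
Qed.

End Splitting.

(** * Separating cliques in chordal graphs *)

Section ChordalGraphs.
Set Implicit Arguments.
Unset Strict Implicit.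
Unset Printing Implicit Defensive.
Variables (T : finType) (e : rel T).
Hypotheses (e_sym : ssrbool.symmetric e) (e_irr : irreflexive e).
Implicit Types (D S W : {set T}).

Definition inner D : rel T := [rel u v | [&& e u v, u \in D & v \in D]].

Lemma inner_sym D : ssrbool.symmetric (inner D).
Proof. by move=> u v; rewrite /inner /= e_sym; congr andb; rewrite andbC. Qed.

(** A shortest path has these properties: a chord or a repetition would shorten
    it. *)
Lemma chordless_path D x y : connect (inner D) x y ->
  exists p, [/\ path e x p, last x p = y, uniq (x :: p), {subset p <= D} &
    forall i j, (i < j <= size p)%N -> e (nth x (x :: p) i) (nth x (x :: p) j) ->
      j = i.+1].
Proof.
move=> /connectP[p0 p0D p0y].
pose P k := `[< exists p, [/\ size p = k, path (inner D) x p & last x p = y] >].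
have exP : exists k, P k by exists (size p0); apply/asboolP; exists p0.
case: (ex_minnP exP) => k /asboolP[p [pk pD py]] kmin.
have minp q : path (inner D) x q -> last x q = y -> (size p <= size q)%N.
  by move=> qD qy; rewrite pk; apply: kmin; apply/asboolP; exists q.
have lastE i : (i <= size p)%N -> nth x (x :: p) i = last x (take i p).
  by move=> ip; rewrite (last_nth x) size_takel // -[x :: take i p]/(take i.+1 (x :: p)) nth_take.
have pE i : path (inner D) x (take i p) && path (inner D) (last x (take i p)) (drop i p).
  by rewrite -cat_path cat_take_drop.
exists p; split => //.
- by apply: sub_path pD => u v /and3P[].
- apply/negPn/negP => /(uniqPn x)[i [j [ij jp nij]]].
  have ip : (i <= size p)%N by apply: leq_trans (ltnW ij) _.
  have := minp (take i p ++ drop j p); rewrite cat_path last_cat.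
  have /andP[-> _] := pE i; have /andP[_] := pE j.
  rewrite -!lastE // nij => -> /(_ isT).
  have -> : last (nth x (x :: p) j) (drop j p) = y.
    by rewrite lastE // -last_cat cat_take_drop.
  move=> /(_ erefl); rewrite size_cat size_takel // size_drop.
  by rewrite leqNgt -{2}(subnKC (n := size p) (m := j)) // ltn_add2r ij.
- move=> v vp; move: pD; elim: (p) (x) vp => //= w s IH z; rewrite inE.
  by move=> /orP[/eqP->|vs] /andP[/and3P[_ _ wD] sD] //; exact: IH vs sD.
- move=> i j /andP[ij jp] eij; apply/eqP; rewrite eqn_leq ij andbT leqNgt.
  apply/negP => ij'.
  case: j ij jp eij ij' => // j ij jp eij ij'.
  have ip : (i <= size p)%N by apply: leq_trans (ltnW ij) _.
  have memD k0 : (k0 <= size p)%N -> (0 < size p)%N -> nth x (x :: p) k0 \in D.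
    move=> + sp0; case: k0 => [_|k0 kp] /=.
      by move: pD sp0; case: (p) => //= ? ? /andP[/and3P[]].
    have : nth x p k0 \in p by exact: mem_nth.
    move: (nth x p k0) => v vp; move: pD; elim: (p) (x) vp => //= w s IH z; rewrite inE.
    by move=> /orP[/eqP->|vs] /andP[/and3P[_ _ wD] sD] //; exact: IH vs sD.
  have sp0 : (0 < size p)%N by apply: leq_trans jp.
  have := minp (take i p ++ drop j p); rewrite cat_path last_cat.
  have /andP[-> _] := pE i; rewrite -lastE // (drop_nth x jp) /=.
  have -> : inner D (nth x (x :: p) i) (nth x p j).
    by apply/and3P; split; [exact: eij|exact: memD|exact: memD jp sp0].
  have /andP[_] := pE j.+1; rewrite -lastE // => -> /(_ isT).
  have -> : last (nth x p j) (drop j.+1 p) = y.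
    by rewrite -[nth x p j]/(nth x (x :: p) j.+1) lastE // -last_cat cat_take_drop.
  move=> /(_ erefl); rewrite size_cat size_takel //= size_drop.
  by lia.
Qed.

Lemma next_in_cycle (x y : T) (P Q : seq T) i : uniq (x :: P ++ y :: Q) -> (i <= size P)%N ->
  next (x :: P ++ y :: Q) (nth x (x :: rcons P y) i) = nth x (x :: rcons P y) i.+1.
Proof.
move=> cu iP; set c := x :: _.
have cE : c = (x :: rcons P y) ++ Q by rewrite /= cat_rcons.
have ic : (i < size (x :: rcons P y))%N by rewrite /= size_rcons ltnS leqW.
have -> : nth x (x :: rcons P y) i = nth x c i by rewrite cE nth_cat ic.
have ic' : (i < size c)%N by rewrite cE size_cat ltn_addr.
rewrite next_nth mem_nth // {1}/c index_uniq //.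
by rewrite /= -cat_rcons nth_cat size_rcons ltnS iP.
Qed.

Lemma chordless_next (x y : T) (P Q : seq T) u v : uniq (x :: P ++ y :: Q) ->
  (forall i j, (i < j <= size (rcons P y))%N ->
    e (nth x (x :: rcons P y) i) (nth x (x :: rcons P y) j) -> j = i.+1) ->
  u \in x :: rcons P y -> v \in x :: rcons P y -> e u v ->
  v = next (x :: P ++ y :: Q) u \/ u = next (x :: P ++ y :: Q) v.
Proof.
move=> cu chl uP vP.
rewrite -(nth_index x uP) -(nth_index x vP).
have sz : size (x :: rcons P y) = (size P).+2 by rewrite /= size_rcons.
move: uP vP; rewrite -!index_mem sz.
move: (index u _) (index v _) => i j; rewrite !ltnS => iP jP.
case: (ltngtP i j) => [ij|ji|ij] euv; last first.
  by move: euv; rewrite ij e_irr.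
- have iE : i = j.+1 by apply: chl; rewrite ?ji ?size_rcons // e_sym.
  by right; rewrite iE next_in_cycle // -ltnS -iE.
- have jE : j = i.+1 by apply: chl euv; rewrite ij size_rcons.
  by left; rewrite jE next_in_cycle // -ltnS -jE.
Qed.

Hypothesis e_chordal : chordal e.

(** Chordless paths from [x] to [y] through [D1] and back through [D2] form a
    cycle of length at least 4 when [x] and [y] are not adjacent.  No chord
    joins [D1] to [D2] and none lies within one path, so chordality fails. *)
Lemma connected_sides_adjacent D1 D2 x y :
  x != y -> x \notin D1 :|: D2 -> y \notin D1 :|: D2 -> [disjoint D1 & D2] ->
  (forall u v, u \in D1 -> v \in D2 -> ~~ e u v) ->
  connect (inner (x |: (y |: D1))) x y -> connect (inner (x |: (y |: D2))) y x ->
  e x y.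
Proof.
move=> xy; rewrite !inE !negb_or => /andP[x1 x2] /andP[y1 y2] /pred0P D12 noe c1 c2.
apply/negPn/negP => nexy.
have [p []] := chordless_path c1; case: (lastP p) => [_ /= x_y|P z].
  by rewrite x_y eqxx in xy.
rewrite last_rcons => p1 zE; subst z => uP PD chP.
have [q []] := chordless_path c2; case: (lastP q) => [_ /= x_y|Q z].
  by rewrite x_y eqxx in xy.
rewrite last_rcons => q1 zE; subst z => uQ QD chQ.
have PD1 u : u \in P -> u \in D1.
  move=> uin; have := PD u; rewrite mem_rcons inE uin orbT => /(_ isT).
  move: uP; rewrite /= rcons_uniq mem_rcons inE negb_or => /and3P[/andP[_ xP] yP _].
  have ux : u != x by apply: contraNneq xP => <-.
  have uy : u != y by apply: contraNneq yP => <-.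
  by rewrite !inE (negPf ux) (negPf uy).
have QD2 u : u \in Q -> u \in D2.
  move=> uin; have := QD u; rewrite mem_rcons inE uin orbT => /(_ isT).
  move: uQ; rewrite /= rcons_uniq mem_rcons inE negb_or => /and3P[/andP[_ yQ] xQ _].
  have ux : u != x by apply: contraNneq xQ => <-.
  have uy : u != y by apply: contraNneq yQ => <-.
  by rewrite !inE (negPf ux) (negPf uy).
have cu : uniq (x :: P ++ y :: Q).
  rewrite -cat_rcons -cat_cons cat_uniq uP /=.
  move: uQ; rewrite /= rcons_uniq mem_rcons inE negb_or => /and3P[/andP[_ yQ] xQ ->].
  rewrite andbT; apply/hasPn => u uin; rewrite inE mem_rcons inE !negb_or.
  have u2 := QD2 u uin; apply/and3P; split.
  - by apply: contraTneq uin => ->.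
  - by apply: contraTneq uin => ->.
  - by apply/negP => /PD1 u1; have := D12 u; rewrite /= u1 u2.
have cu' : uniq (y :: Q ++ x :: P).
  by rewrite -cat_cons uniq_catC cat_cons.
have P0 : (0 < size P)%N.
  by case: (P) p1 => //=; rewrite andbT (negPf nexy).
have Q0 : (0 < size Q)%N.
  by case: (Q) q1 => //= /andP[]; rewrite e_sym (negPf nexy).
have cyc : cycle e (x :: P ++ y :: Q).
  by rewrite /= rcons_cat /= -cat_rcons cat_path p1 last_rcons.
have rotE : next (y :: Q ++ x :: P) =1 next (x :: P ++ y :: Q).
  move=> u; have := next_rot (size (x :: P)) cu u.
  by rewrite -cat_cons rot_size_cat.
have sz : (4 <= size (x :: P ++ y :: Q))%N.
  by rewrite /= size_cat /=; move: (size P) (size Q) P0 Q0; clear; lia.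
have [u [v [uc vc euv /eqP nuv /eqP nvu]]] := e_chordal sz cu cyc.
have inP w : w \in x :: P ++ y :: Q -> w \notin Q -> w \in x :: rcons P y.
  by rewrite !inE mem_rcons mem_cat !inE; case: (w \in Q) => //; rewrite orbF [(w == y) || _]orbC.
have inQ w : w \in x :: P ++ y :: Q -> w \notin P -> w \in y :: rcons Q x.
  rewrite !inE mem_rcons mem_cat !inE; case: (w \in P) => //= + _.
  by case: (w == x); case: (w == y).
have [uQ'|uQ'] := boolP ((u \in P) || (v \in P)); last first.
  move: uQ'; rewrite negb_or => /andP[uP' vP'].
  by have [] := chordless_next cu' chQ (inQ _ uc uP') (inQ _ vc vP') euv; rewrite rotE.
have [uQ''|uQ''] := boolP ((u \in Q) || (v \in Q)); last first.
  move: uQ''; rewrite negb_or => /andP[uP' vP'].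
  by have [] := chordless_next cu chP (inP _ uc uP') (inP _ vc vP') euv.
have dPQ w : w \in P -> w \in Q -> False.
  by move=> /PD1 w1 /QD2 w2; have := D12 w; rewrite /= w1 w2.
case/orP: uQ' => [uP'|vP']; case/orP: uQ'' => [uQ'|vQ'].
- exact: dPQ uP' uQ'.
- by have := noe _ _ (PD1 _ uP') (QD2 _ vQ'); rewrite euv.
- by have := noe _ _ (PD1 _ vP') (QD2 _ uQ'); rewrite e_sym euv.
- exact: dPQ vP' vQ'.
Qed.

(** Dirac's theorem: an inclusion-minimal set [S] separating two nonadjacent
    vertices [a] and [b] is a clique.  Each vertex of [S] has neighbours in the
    components [A] of [a] and [B] of [b], so [connected_sides_adjacent] applies
    to any two of them.  The two parts are [A :|: S] and the complement of [A];
    no edge joins [A] to the outside of [A :|: S], so a clique that meets [A]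
    stays in the first part. *)
Lemma chordal_split W : ~~ clique e W ->
  exists V1 V2 : {set T}, [/\ V1 \proper W, V2 \proper W, clique e (V1 :&: V2) &
    forall K : {set T}, K \subset W -> clique e K -> K \subset V1 \/ K \subset V2].
Proof.
rewrite /clique => /forall_inPn[a aW] /forall_inPn[b bW].
rewrite negb_imply => /andP[ab neab].
pose sep S := [&& S \subset W, a \notin S, b \notin S & ~~ connect (inner (W :\: S)) a b].
have sep0 : sep (W :\: [set a; b]).
  rewrite /sep subsetDl !inE !eqxx orbT /=; apply/negP => /chordless_path.
  move=> [[|z s] [/= + + + zD _]]; first by move=> _ E; rewrite E eqxx in ab.
  have : z \in W :\: (W :\: [set a; b]) by apply: zD; rewrite inE eqxx.
  rewrite !inE negb_and negbK => /andP[/orP[/orP[]/eqP->|/negPf->//] _].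
    by rewrite e_irr.
  by rewrite (negPf neab).
have [S /minsetP[/and4P[SW aS bS nab] minS] _] := minset_exists sep0.
pose A := [set z | connect (inner (W :\: S)) a z].
pose B := [set z | connect (inner (W :\: S)) b z].
have csym D : connect_sym (inner D) by apply: sym_connect_sym; exact: inner_sym.
have aWS : a \in W :\: S by rewrite inE aS.
have bWS : b \in W :\: S by rewrite inE bS.
have comp_sub d z : d \in W :\: S -> connect (inner (W :\: S)) d z -> z \in W :\: S.
  move=> dW /connectP[p]; elim/last_ind: p => [_ -> //|p v _].
  by rewrite rcons_path last_rcons => /andP[_ /and3P[_ _ +]] ->.
have AW z : z \in A -> z \in W :\: S by rewrite inE; exact: comp_sub.
have BW z : z \in B -> z \in W :\: S by rewrite inE; exact: comp_sub.
have noAB u v : u \in A -> v \in W :\: S -> e u v -> v \in A.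
  move=> uA vW uv; rewrite inE; move: (uA); rewrite inE => /connect_trans; apply.
  by apply: connect1; rewrite /inner /= uv vW AW.
have noBA u v : u \in B -> v \in W :\: S -> e u v -> v \in B.
  move=> uA vW uv; rewrite inE; move: (uA); rewrite inE => /connect_trans; apply.
  by apply: connect1; rewrite /inner /= uv vW BW.
have AB z : z \in A -> z \in B -> False.
  by rewrite !inE => az; rewrite csym => zb; move: nab; rewrite (connect_trans az zb).
have reconn x : x \in S -> connect (inner (W :\: (S :\ x))) a b.
  move=> xS; apply/negPn/negP => nab'.
  have /minS/(_ (subsetDl _ _)) SE : sep (S :\ x).
    by rewrite /sep nab' !inE !negb_and aS bS !orbT (subset_trans (subsetDl _ _) SW).
  by move: xS; rewrite -SE !inE eqxx.
(* Putting a vertex [x] of [S] back reconnects [a] and [b]; a component without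
   a neighbour of [x] would stay closed and prevent this. *)
have nbr (C : {set T}) d d' x : x \in S -> d \in C -> d' \notin C ->
    (forall u v, u \in C -> v \in W :\: S -> e u v -> v \in C) ->
    connect (inner (W :\: (S :\ x))) d d' -> exists2 x', x' \in C & e x x'.
  move=> xS dC d'C clC dd'.
  have [/exists_inP[x' x'C xx']|/exists_inPn noC] := boolP [exists x' in C, e x x'].
    by exists x'.
  suff : d' \in C by rewrite (negPf d'C).
  move: dd' => /connectP[p pp ->].
  elim: p d dC pp {d'C} => //= w p IH d dC /andP[/and3P[dw _ wW] pp].
  apply: IH pp; move: wW; rewrite !inE negb_and negbK => /andP[/orP[/eqP wx|wS] wW].
    by have := noC _ dC; rewrite -wx e_sym dw.
  by apply: clC dC _ dw; rewrite inE wS.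
have bA : b \notin A by rewrite inE.
have aB : a \notin B by rewrite inE csym.
have aA : a \in A by rewrite inE.
have bB : b \in B by rewrite inE.
have nbrA x : x \in S -> exists2 x', x' \in A & e x x'.
  by move=> xS; apply: nbr xS aA bA noAB (reconn x xS).
have nbrB x : x \in S -> exists2 x', x' \in B & e x x'.
  by move=> xS; have := reconn x xS; rewrite csym; exact: nbr xS bB aB noBA.
have joinC (C : {set T}) d x y : d \in W :\: S ->
    C = [set z | connect (inner (W :\: S)) d z] ->
    (exists2 x', x' \in C & e x x') -> (exists2 y', y' \in C & e y y') ->
    connect (inner (x |: (y |: C))) x y.
  move=> dW CE [x' x'C xx'] [y' y'C yy'].
  apply: connect_trans (_ : connect _ x' y).
    by apply: connect1; rewrite /inner /= !inE xx' x'C eqxx !orbT.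
  apply: connect_trans (_ : connect _ y' y); last first.
    by apply: connect1; rewrite /inner /= e_sym !inE yy' y'C eqxx !orbT.
  have : connect (inner (W :\: S)) x' y'.
    move: x'C y'C; rewrite CE !inE => dx dy; apply: connect_trans dy; by rewrite csym.
  move=> /connectP[p + ->]; elim: p x' x'C {xx'} => //= w p IH u uC /andP[/and3P[uw uW wW] pp].
  have wC : w \in C.
    move: uC; rewrite CE !inE => /connect_trans; apply; apply: connect1.
    by rewrite /inner /= uw uW.
  apply: connect_trans (IH w wC pp); apply: connect1.
  by rewrite /inner /= uw !inE uC wC !orbT.
have Scl : clique e S.
  apply/forall_inP => x xS; apply/forall_inP => y yS; apply/implyP => xy.
  apply: (@connected_sides_adjacent A B) => //.
  - by rewrite inE negb_or; apply/andP; split; apply/negP; [move=> /AW|move=> /BW]; rewrite inE xS.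
  - by rewrite inE negb_or; apply/andP; split; apply/negP; [move=> /AW|move=> /BW]; rewrite inE yS.
  - by apply/pred0P => z; apply/negP => /andP[]; exact: AB.
  - move=> u v uA vB; apply/negP => uv.
    exact: AB (noAB _ _ uA (BW _ vB) uv) vB.
  - exact: joinC aWS (erefl A) (nbrA x xS) (nbrA y yS).
  - by rewrite setUCA; exact: joinC bWS (erefl B) (nbrB y yS) (nbrB x xS).
exists (A :|: S), (W :\: A); split.
- apply/properP; split; last by exists b; rewrite // inE negb_or bA.
  by rewrite subUset SW andbT; apply/subsetP => z /AW; rewrite inE => /andP[].
- apply/properP; split; first exact: subsetDl.
  by exists a; rewrite // inE aA.
- suff -> : (A :|: S) :&: (W :\: A) = S by [].
  apply/setP => z; rewrite in_setI in_setU in_setD.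
  have [zA|zA] /= := boolP (z \in A).
    by have /setDP[_ /negPf->] := AW _ zA.
  by have [/(subsetP SW)->|] := boolP (z \in S).
move=> K KW Kcl.
have [KA|/exists_inPn nKA] := boolP [exists u in K, u \in A]; last first.
  by right; apply/subsetP => z zK; rewrite inE nKA // (subsetP KW).
left; have /exists_inP[u uK uA] := KA.
apply/subsetP => z zK; rewrite inE; have [//|zS] := boolP (z \in S); first by rewrite orbT.
rewrite orbF; have [<-//|uz] := eqVneq u z.
apply: noAB uA _ _; first by rewrite inE zS (subsetP KW).
by move: Kcl => /forall_inP/(_ u uK)/forall_inP/(_ z zK); rewrite uz.
Qed.

End ChordalGraphs.

(** * Sparse positivity certificates *)

Section SparsePositivity.
Set Implicit Arguments.
Unset Strict Implicit.
Unset Printing Implicit Defensive.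
Variables (R : realType) (n : nat) (c : R) (e : rel 'I_n).
Hypotheses (c_gt0 : 0 < c) (e_sym : ssrbool.symmetric e) (e_irr : irreflexive e).
Hypothesis e_chordal : chordal e.
Implicit Types (p g s : mpoly n R) (V W K : {set 'I_n}) (x : 'rV[R]_n).

Definition sparse p := forall a, a \in msupp p -> clique e (mono_vars a).

Lemma cliqueS V W : V \subset W -> clique e W -> clique e V.
Proof.
move=> VW /forall_inP Wc; apply/forall_inP => i /(subsetP VW) iW.
apply/forall_inP => j /(subsetP VW) jW; exact: (forall_inP (Wc i iW)).
Qed.

Lemma sparseD p q : sparse p -> sparse q -> sparse (p + q).
Proof. by move=> ps qs a /msuppD_le; rewrite mem_cat => /orP[/ps|/qs]. Qed.

Lemma sparse_clique K p : clique e K -> in_polyring K p -> sparse p.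
Proof. by move=> Kc /in_polyringP pK a /pK aK; exact: cliqueS Kc. Qed.

Lemma sparse_sum I (r : seq I) (P : pred I) (F : I -> mpoly n R) :
  (forall i, P i -> sparse (F i)) -> sparse (\sum_(i <- r | P i) F i).
Proof.
by move=> H; elim/big_ind: _ => //; [move=> a; rewrite msupp0|exact: sparseD].
Qed.

Lemma sparse_split p W V1 V2 : sparse p -> in_polyring W p ->
  (forall K, K \subset W -> clique e K -> K \subset V1 \/ K \subset V2) ->
  exists p1 p2, [/\ p = p1 + p2, sparse p1 /\ in_polyring V1 p1 &
    sparse p2 /\ in_polyring V2 p2].
Proof.
move=> ps /in_polyringP pW V12.
pose term (a : multinom n) := mcoeff a p *: mpolyX R a.
have termP V a : mono_vars a \subset V -> in_polyring V (term a).
  move=> aV; apply/in_polyringP => b /msuppZ_le; rewrite msuppX inE.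
  by move=> /eqP->.
exists (\sum_(a <- msupp p | mono_vars a \subset V1) term a).
exists (\sum_(a <- msupp p | ~~ (mono_vars a \subset V1)) term a).
have termS a : a \in msupp p -> sparse (term a).
  by move=> ap; exact: sparse_clique (ps a ap) (termP _ _ (subxx _)).
split.
- by rewrite [LHS]mpolyE (bigID (fun a : multinom n => mono_vars a \subset V1)).
- split; last by apply: in_polyring_sum => a; exact: termP.
  by rewrite big_seq_cond; apply: sparse_sum => a /andP[/termS].
- split; rewrite big_seq_cond.
    by apply: sparse_sum => a /andP[/termS].
  apply: in_polyring_sum => a /andP[ap aV1]; apply: termP.
  by have [|//] := V12 _ (pW a ap) (ps a ap); rewrite (negPf aV1).
Qed.

Variable Cone : mpoly n R -> Prop.
Hypothesis coneD : forall p q, Cone p -> Cone q -> Cone (p + q).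
Hypothesis cone_clique : forall K p, clique e K -> in_polyring K p ->
  (forall x, cube c x -> 0 < eval p x) -> Cone p.

(** Induction on the vertex set [W]: a clique is the base case, and otherwise
    the two parts of [chordal_split] are smaller. *)
Theorem sparse_cube_positivstellensatz p : sparse p ->
  (forall x, cube c x -> 0 < eval p x) -> Cone p.
Proof.
have [k] := ubnP #|[set: 'I_n]|; have := in_polyringT p.
elim: k [set: 'I_n] p => // k IH W p pW; rewrite ltnS => Wk ps ppos.
have [Wc|/(chordal_split e_sym e_irr e_chordal)] := boolP (clique e W).
  exact: cone_clique Wc pW ppos.
move=> [V1 [V2 [V1W V2W Sc V12]]].
have [p1 [p2 [pE [s1 p1V] [s2 p2V]]]] := sparse_split ps pW V12.
rewrite pE in ppos *.
have [h hS [h1 h2]] := split_pos c_gt0 p1V p2V ppos.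
have hs : sparse h := sparse_clique Sc hS.
rewrite (_ : p1 + p2 = (p1 - h) + (p2 + h)); last by ring.
have hV1 := in_polyringS (subsetIl _ _) hS.
have hV2 := in_polyringS (subsetIr _ _) hS.
apply: coneD.
- apply: (IH V1) => //; first exact: in_polyringB.
    exact: leq_trans (proper_card V1W) Wk.
  by apply: sparseD => //; exact: sparse_clique Sc (in_polyringN hS).
- apply: (IH V2) => //; first exact: in_polyringD.
    exact: leq_trans (proper_card V2W) Wk.
  exact: sparseD.
Qed.

Lemma bernoulli_ge (z : R) m : 0 <= z -> 1 + m%:R * z <= (1 + z) ^+ m.
Proof.
move=> z0; elim: m => [|m IH]; first by rewrite mul0r addr0.
rewrite exprS; apply: le_trans (ler_wpM2l (addr_ge0 ler01 z0) IH).
by have := mulr_ge0 (mulr_ge0 (ler0n R m) z0) z0; rewrite -natr1; nra.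
Qed.

Lemma bernoulli_le (z : R) m : 0 <= z <= 1 -> (1 - z) ^+ m * (1 + m%:R * z) <= 1.
Proof.
move=> /andP[z0 z1]; elim: m => [|m IH]; first by rewrite mul0r addr0 mulr1.
apply: le_trans IH; rewrite exprS mulrC mulrA mulrC.
apply: ler_wpM2l; first by rewrite exprn_ge0 // subr_ge0.
by have := mulr_ge0 (mulr_ge0 (ler0n R m) z0) z0; rewrite -natr1; nra.
Qed.

(** By compactness there is [d > 0] such that [p >= d] or [g <= - d] at each
    point.  Where [p >= d], the penalty must be below [d] if [g >= 0], and it is
    helpful if [g < 0]; where [g <= - d], it must make up for a bound [B] of
    [- p].  With [z = g / G] in [-1, 1], the square of
    [(1 - z) ^ k] does both: it is at least [1 + 2 * k * (- z)] for [z < 0], and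
    its product with [z] is at most [1 / (2 * k)] for [z >= 0]. *)
Lemma penalty (C : set 'rV[R]_n) p g : compact C ->
  (forall x, C x -> 0 <= eval g x -> 0 < eval p x) ->
  exists s, (forall V, in_polyring V g -> in_polyring V s) /\
    forall x, C x -> 0 < eval (p - s ^+ 2 * g) x.
Proof.
move=> Cc pg.
have hc : continuous (fun x => Num.max (eval p x) (- eval g x)).
  move=> x; apply: continuous_max; first exact: eval_continuous.
  by apply: continuousN; exact: eval_continuous.
have [x Cx|d d0 dmin] := compact_pos_bound Cc hc.
  rewrite lt_max; have [g0|g0] := leP 0 (eval g x); first by rewrite pg.
  by rewrite oppr_gt0 g0 orbT.
have [G G0 gG] := compact_eval_bound g Cc.
have [B B0 pB] := compact_eval_bound p Cc.
pose k := (Num.truncn (G / d + B * G / d ^+ 2)).+1.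
have kP : G / d + B * G / d ^+ 2 < k%:R by rewrite truncnS_gt.
have kd : G < k%:R * d.
  rewrite -ltr_pdivrMr //; apply: le_lt_trans kP; rewrite lerDl.
  by rewrite divr_ge0 ?mulr_ge0 ?sqr_ge0 // ltW.
have kB : B < k%:R * (d / G) * d.
  have : B * G / d ^+ 2 < k%:R.
    by apply: le_lt_trans kP; rewrite lerDr divr_ge0 // ltW.
  rewrite ltr_pdivrMr ?exprn_gt0 // => H.
  by rewrite -mulrA mulrAC mulrA ltr_pdivlMr // -mulrA -expr2.
exists ((1 - mpolyC n G^-1 * g) ^+ k); split=> [V gV|x Cx].
  apply: in_polyringX; apply: in_polyringB; first exact: in_polyring1.
  by apply: in_polyringM => //; exact: in_polyringC.
rewrite !evalE -exprM mulnC mul2n -addnn.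
have /ler_normlP[gG1 gG2] := gG x Cx; have /ler_normlP[pB1 pB2] := pB x Cx.
move: (eval g x) (eval p x) gG1 gG2 pB1 pB2 (dmin x Cx) => y v y1 y2 v1 v2.
have yE : y = G * (G^-1 * y) by rewrite mulrA mulfV ?mul1r // gt_eqF.
have kk : (k <= k + k)%N by rewrite leq_addr.
have kR : (k%:R : R) <= (k + k)%:R by rewrite ler_nat.
have k0 : (0 : R) < k%:R by rewrite ltr0n.
move: kk kR; set m := (k + k)%N => kk kR.
have me : ~~ odd m by rewrite /m addnn odd_double.
clearbody m.
rewrite le_max; have [y0|y0] := leP 0 y.
  have z01 : 0 <= G^-1 * y <= 1.
    by rewrite mulr_ge0 ?invr_ge0 ?(ltW G0) //= mulrC ler_pdivrMr // mul1r.
  have := bernoulli_le m z01; have /andP[z0 _] := z01.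
  move: (G^-1 * y) yE z0 z01 => z yE z0 /andP[_ z1].
  have w0 : 0 <= (1 - z) ^+ m by rewrite exprn_ge0 // subr_ge0.
  move: ((1 - z) ^+ m) w0 => w w0 H /orP[dv|dy]; last by lra.
  have wz0 := mulr_ge0 w0 z0.
  have H1 : k%:R * (w * z) <= 1.
    by have := ler_wpM2r wz0 kR; lra.
  have H2 : k%:R * d * (w * z) <= d by have := ler_wpM2l (ltW d0) H1; lra.
  have [wz|wz] := eqVneq (w * z) 0.
    by rewrite yE mulrCA wz mulr0 subr0 (lt_le_trans d0).
  have wz1 : 0 < w * z by rewrite lt0r wz.
  have : G * (w * z) < k%:R * d * (w * z) by rewrite ltr_pM2r.
  by rewrite yE mulrCA; lra.
have w0 : 0 <= (1 - G^-1 * y) ^+ m by rewrite exprn_even_ge0.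
move=> /orP[dv|dy].
  have : 0 <= (1 - G^-1 * y) ^+ m * - y by rewrite mulr_ge0 // oppr_ge0 ltW.
  by rewrite mulrN; lra.
have z0 : 0 <= - (G^-1 * y) by rewrite -mulrN mulr_ge0 ?invr_ge0 ?(ltW G0) // oppr_ge0 ltW.
have := bernoulli_ge m z0.
have dz : d / G <= - (G^-1 * y) by rewrite -mulrN mulrC ler_wpM2l // invr_ge0 ltW.
have H : k%:R * (d / G) <= m%:R * - (G^-1 * y).
  by rewrite ler_pM // ?(ltW k0) // divr_ge0 // ltW.
move=> bern.
have wk : k%:R * (d / G) <= (1 - G^-1 * y) ^+ m by lra.
have : k%:R * (d / G) * d <= (1 - G^-1 * y) ^+ m * - y.
  by rewrite ler_pM // ?(ltW d0) // mulr_ge0 ?(ltW k0) // divr_ge0 // ltW.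
by rewrite mulrN; lra.
Qed.

Lemma compact_feasible (Gs : seq (mpoly n R)) :
  compact [set x | cube c x /\ forall g, g \in Gs -> 0 <= eval g x]%classic.
Proof.
elim: Gs => [|g Gs IH].
  rewrite (_ : [set x | _]%classic = cube c); first exact: cube_compact.
  by apply/seteqP; split => [x []|x cx].
rewrite (_ : [set x | _]%classic =
  ([set x | cube c x /\ forall g, g \in Gs -> 0 <= eval g x] `&`
   [set x | 0 <= eval g x])%classic).
  by apply: compact_closedI => //; exact: closed_eval_ge0.
apply/seteqP; split => [x [cx H]|x [[cx H] gx]]; split => //.
- by split=> // g' g'G; apply: H; rewrite inE g'G orbT.
- by apply: H; rewrite inE eqxx.
- by move=> g'; rewrite inE => /orP[/eqP->//|]; exact: H.
Qed.

(** The constraints are removed one by one with [penalty], on the compact set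
    cut out by the remaining ones. *)
Theorem sparse_positivstellensatz (Gs : seq (mpoly n R)) p : sparse p ->
  (forall g, g \in Gs -> exists K, [/\ clique e K, in_polyring K g &
     forall s, in_polyring K s -> Cone (s ^+ 2 * g)]) ->
  (forall x, cube c x -> (forall g, g \in Gs -> 0 <= eval g x) -> 0 < eval p x) ->
  Cone p.
Proof.
elim: Gs p => [|g Gs IH] p ps Gc ppos.
  by apply: sparse_cube_positivstellensatz => // x cx; exact: ppos.
have [K [Kc gK Kg]] : exists K, [/\ clique e K, in_polyring K g &
     forall s, in_polyring K s -> Cone (s ^+ 2 * g)] by apply: Gc; rewrite inE eqxx.
have [x [cx H] gx|s [/(_ K gK) sK spos]] := @penalty _ p g (@compact_feasible Gs).
  by apply: ppos => // g'; rewrite inE => /orP[/eqP->//|]; exact: H.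
rewrite -[p](subrK (s ^+ 2 * g)); apply: coneD; last exact: Kg.
apply: IH => [|g' g'G|x cx H]; last exact: spos.
  apply: sparseD => //; apply: sparse_clique Kc _; apply: in_polyringN.
  by apply: in_polyringM => //; exact: in_polyringX.
by apply: Gc; rewrite inE g'G orbT.
Qed.

End SparsePositivity.

(** * Quadratic modules and truncations *)

Section QuadraticModules.
Set Implicit Arguments.
Unset Strict Implicit.
Unset Printing Implicit Defensive.
Variables (R : realType) (n : nat).
Implicit Types (p g h s : mpoly n R) (V K : {set 'I_n}) (x : 'rV[R]_n).
Local Notation cst := (@mpolyC n R).
Local Notation X i := (mvar R i).

Definition sos V p := exists2 t : seq (mpoly n R),
  (forall r, r \in t -> in_polyring V r) & p = \sum_(r <- t) r ^+ 2.

Lemma sos_sqr V p : in_polyring V p -> sos V (p ^+ 2).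
Proof.
by move=> pV; exists [:: p]; rewrite ?big_seq1 // => r; rewrite inE => /eqP->.
Qed.

Lemma sos0 V : sos V 0.
Proof. by exists [::]; rewrite ?big_nil. Qed.

Lemma sosD V p q : sos V p -> sos V q -> sos V (p + q).
Proof.
move=> [t tV ->] [t' tV' ->]; exists (t ++ t'); last by rewrite big_cat.
by move=> r; rewrite mem_cat => /orP[/tV|/tV'].
Qed.

Lemma sos_sum V I (r : seq I) (P : pred I) (F : I -> mpoly n R) :
  (forall i, P i -> sos V (F i)) -> sos V (\sum_(i <- r | P i) F i).
Proof. by move=> H; elim/big_ind: _ => //; [exact: sos0|exact: sosD]. Qed.

Lemma sosM V p q : sos V p -> sos V q -> sos V (p * q).
Proof.
move=> [t tV ->] [t' tV' ->]; rewrite big_distrlr /= big_seq.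
apply: sos_sum => r rt; rewrite big_seq; apply: sos_sum => r' rt'.
by rewrite -exprMn; apply: sos_sqr; apply: in_polyringM; [exact: tV|exact: tV'].
Qed.

Lemma sos_cst V (a : R) : 0 <= a -> sos V (cst a).
Proof.
move=> a0; rewrite -[a]sqr_sqrtr // rmorphXn /=; apply: sos_sqr.
exact: in_polyringC.
Qed.

Lemma sos_polyring V p : sos V p -> in_polyring V p.
Proof.
move=> [t tV ->]; rewrite big_seq; apply: in_polyring_sum => r /tV.
exact: in_polyringX.
Qed.

(** For a single generator the quadratic module is closed under products, which
    fails for the several generators [1 - X i ^ 2]. *)
Definition ball_poly V : mpoly n R := cst #|V|%:R - \sum_(i in V) X i ^+ 2.

Definition ball_module V p :=
  exists s0 s1, [/\ sos V s0, sos V s1 & p = s0 + ball_poly V * s1].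

Lemma ball_poly_polyring V : in_polyring V (ball_poly V).
Proof.
apply: in_polyringB; first exact: in_polyringC.
by apply: in_polyring_sum => i iV; apply: in_polyringX; exact: in_polyring_mvar.
Qed.

(** Here [c + X i] is [((c + X i) ^ 2 + (c ^ 2 - X i ^ 2)) / (2 * c)], and
    [c ^ 2 - X i ^ 2] exceeds the ball polynomial by a constant and the squares
    of the other variables. *)
Lemma arch_ball_module V (c : R) : 0 < c -> #|V|%:R <= c ^+ 2 ->
  arch_preordering c V (ball_module V).
Proof.
move=> c0 cV.
have lin i (b : R) : i \in V -> b ^+ 2 = 1 -> ball_module V (cst c + cst b * X i).
  move=> iV b2; pose k := (2 * c)^-1.
  have k0 : 0 <= k by rewrite invr_ge0 mulr_ge0 // ltW.
  have kc : cst k * cst c * 2 = 1.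
    rewrite -[2](rmorph_nat cst) -!rmorphM /= -[RHS](rmorph1 cst); congr cst.
    by rewrite /k; field; rewrite gt_eqF.
  exists (cst k * ((cst c + cst b * X i) ^+ 2 + cst (c ^+ 2 - #|V|%:R)
            + \sum_(j in V | j != i) X j ^+ 2)), (cst k); split.
  - apply: sosM; first exact: sos_cst.
    apply: sosD; first apply: sosD.
    + apply: sos_sqr; apply: in_polyringD; first exact: in_polyringC.
      by apply: in_polyringM; [exact: in_polyringC|exact: in_polyring_mvar].
    + by apply: sos_cst; rewrite subr_ge0.
    + by apply: sos_sum => j /andP[jV _]; apply: sos_sqr; exact: in_polyring_mvar.
  - exact: sos_cst.
  - rewrite /ball_poly [S in cst _ - S](bigD1 i) //=.
    transitivity (cst k * cst c * 2 * (cst c + cst b * X i)).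
      by rewrite kc mul1r.
    have bb : cst b ^+ 2 = 1 by rewrite -rmorphXn /= b2 rmorph1.
    transitivity (cst k * (cst c ^+ 2 + 2 * cst c * cst b * X i
        + cst b ^+ 2 * X i ^+ 2 + cst c ^+ 2 - X i ^+ 2)); last by ring.
    by rewrite bb; ring.
split.
- move=> p q [s0 [s1 [S0 S1 ->]]] [t0 [t1 [T0 T1 ->]]].
  exists (s0 + t0), (s1 + t1); split; [exact: sosD|exact: sosD|by ring].
- move=> p q [s0 [s1 [S0 S1 ->]]] [t0 [t1 [T0 T1 ->]]].
  exists (s0 * t0 + ball_poly V ^+ 2 * (s1 * t1)), (s0 * t1 + s1 * t0); split.
  + apply: sosD; first exact: sosM.
    by apply: sosM; [exact/sos_sqr/ball_poly_polyring|exact: sosM].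
  + by apply: sosD; exact: sosM.
  + by ring.
- move=> p pV; exists (p ^+ 2), 0; split; [exact: sos_sqr|exact: sos0|by ring].
- by move=> i iV; have := lin i 1 iV (expr1n _ 2); rewrite rmorph1 mul1r.
- by move=> i iV; have := lin i (-1) iV (sqrr_sign _ 1); rewrite rmorphN rmorph1 mulN1r.
Qed.

(** The ideal and the quadratic module without degree bounds; finitely many
    multipliers are involved, so every large enough truncation contains a
    given element. *)
Definition ideal (Hs : seq (mpoly n R)) V p :=
  exists2 c : mpoly n R -> mpoly n R,
    (forall h, h \in Hs -> in_polyring V (c h)) & p = \sum_(h <- undup Hs) h * c h.

Definition qmodule (Gs : seq (mpoly n R)) V p :=
  exists (s0 : mpoly n R) (s : mpoly n R -> mpoly n R),
    [/\ sos V s0, (forall g, g \in Gs -> sos V (s g))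
      & p = s0 + \sum_(g <- undup Gs) g * s g].

Lemma sum_undup_single (Hs : seq (mpoly n R)) h s : h \in Hs ->
  \sum_(h' <- undup Hs) h' * (if h' == h then s else 0) = h * s.
Proof.
move=> hH; rewrite (bigD1_seq h) ?mem_undup ?undup_uniq //= eqxx big1 ?addr0 //.
by move=> h' /negPf->; rewrite mulr0.
Qed.

Lemma ideal_gen Hs V h s : h \in Hs -> in_polyring V s -> ideal Hs V (h * s).
Proof.
move=> hH sV; exists (fun h' => if h' == h then s else 0).
  by move=> h' _; case: ifP => // _; exact: in_polyring0.
by rewrite sum_undup_single.
Qed.

Lemma ideal0 Hs V : ideal Hs V 0.
Proof.
exists (fun=> 0); first by move=> h' _; exact: in_polyring0.
by rewrite big1 // => h _; rewrite mulr0.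
Qed.

Lemma idealD Hs V p q : ideal Hs V p -> ideal Hs V q -> ideal Hs V (p + q).
Proof.
move=> [c cV ->] [d dV ->]; exists (fun h => c h + d h).
  by move=> h hH; apply: in_polyringD; [exact: cV|exact: dV].
by rewrite -big_split; apply: eq_bigr => h _; rewrite mulrDr.
Qed.

Lemma qmodule_gen Gs V g s : g \in Gs -> sos V s -> qmodule Gs V (g * s).
Proof.
move=> gG sV; exists 0, (fun g' => if g' == g then s else 0).
split; [exact: sos0| |by rewrite sum_undup_single // add0r].
by move=> g' _; case: ifP => // _; exact: sos0.
Qed.

Lemma qmodule_sos Gs V s : sos V s -> qmodule Gs V s.
Proof.
move=> sV; exists s, (fun=> 0); split=> // [g _|]; first exact: sos0.
by rewrite big1 ?addr0 // => h _; rewrite mulr0.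
Qed.

Lemma qmoduleD Gs V p q : qmodule Gs V p -> qmodule Gs V q -> qmodule Gs V (p + q).
Proof.
move=> [s0 [s [S0 S ->]]] [t0 [t [T0 T' ->]]]; exists (s0 + t0), (fun g => s g + t g).
split; [exact: sosD|by move=> g gG; apply: sosD; [exact: S|exact: T']|].
under [in RHS]eq_bigr do rewrite mulrDr.
by rewrite big_split /=; ring.
Qed.

Lemma ball_module_qmodule Gs V p : (forall i, i \in V -> 1 - X i ^+ 2 \in Gs) ->
  ball_module V p -> qmodule Gs V p.
Proof.
move=> Vbox [s0 [s1 [S0 S1 ->]]]; apply: qmoduleD; first exact: qmodule_sos.
have -> : ball_poly V = \sum_(i in V) (1 - X i ^+ 2).
  by rewrite sumrB sumr_const /ball_poly rmorph_nat.
rewrite mulr_suml; elim/big_ind: _ => [||i iV]; [|exact: qmoduleD|].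
  by apply: qmodule_sos; exact: sos0.
by apply: qmodule_gen => //; exact: Vbox.
Qed.

Lemma seq_bounded (T : eqType) (s : seq T) (F : T -> nat) :
  exists k : nat, forall y, y \in s -> (F y <= k)%N.
Proof.
elim: s => [|y s [k Hk]]; first by exists 0%N.
exists (maxn (F y) k) => z; rewrite inE => /orP[/eqP->|/Hk zk].
  exact: leq_maxl.
by rewrite (leq_trans zk) // leq_maxr.
Qed.

Lemma ideal_truncated Hs V p : ideal Hs V p ->
  exists k0, forall k, (k0 <= k)%N -> in_ideal Hs V k p.
Proof.
move=> [c cV pE].
have [K HK] := seq_bounded Hs (fun h => degree h + mmeasure mdeg (c h))%N.
exists K => k Kk; exists c => // h hH; split; first exact: cV.
by have := HK h hH; lia.
Qed.

Lemma qmodule_truncated Gs V p : qmodule Gs V p ->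
  exists k0, forall k, (k0 <= k)%N -> in_qmodule Gs V k p.
Proof.
move=> [s0 [s [S0 S pE]]].
have [K HK] := seq_bounded Gs (fun g => 2 * uphalf (degree g) + mmeasure mdeg (s g))%N.
exists (maxn K (mmeasure mdeg s0)) => k; rewrite geq_max => /andP[Kk s0k].
exists s0, s; split=> // [|g gG].
  by split=> //; split; [exact: sos_polyring|lia].
split; last exact: S.
by split; [exact/sos_polyring/S|have := HK g gG; lia].
Qed.

End QuadraticModules.

Section SparseCone.
Set Implicit Arguments.
Unset Strict Implicit.
Unset Printing Implicit Defensive.
Variables (R : realType) (n q : nat) (U : 'I_q -> {set 'I_n}).
Variables (Hs Gs : 'I_q -> seq (mpoly n R)).
Implicit Types (p g h s : mpoly n R).

Definition sparse_cone p := exists a b : 'I_q -> mpoly n R,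
  [/\ forall l, ideal (Hs l) (U l) (a l), forall l, qmodule (Gs l) (U l) (b l)
    & p = \sum_l a l + \sum_l b l].

Lemma sparse_coneD p p' : sparse_cone p -> sparse_cone p' -> sparse_cone (p + p').
Proof.
move=> [a [b [aH bG ->]]] [a' [b' [aH' bG' ->]]].
exists (fun l => a l + a' l), (fun l => b l + b' l); split.
- by move=> l; exact: idealD.
- by move=> l; exact: qmoduleD.
- by rewrite !big_split /=; ring.
Qed.

Lemma sum_ord_single (l : 'I_q) p : \sum_j (if j == l then p else 0) = p.
Proof. by rewrite -big_mkcond big_pred1_eq. Qed.

Lemma sparse_cone_ideal l p : ideal (Hs l) (U l) p -> sparse_cone p.
Proof.
move=> pI; exists (fun j => if j == l then p else 0), (fun=> 0); split.
- by move=> j; case: eqP => [->//|_]; exact: ideal0.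
- by move=> j; apply: qmodule_sos; exact: sos0.
- by rewrite sum_ord_single big1 ?addr0.
Qed.

Lemma sparse_cone_qmodule l p : qmodule (Gs l) (U l) p -> sparse_cone p.
Proof.
move=> pI; exists (fun=> 0), (fun j => if j == l then p else 0); split.
- by move=> j; exact: ideal0.
- by move=> j; case: eqP => [->//|_]; apply: qmodule_sos; exact: sos0.
- by rewrite sum_ord_single big1 ?add0r.
Qed.

Lemma uniform_threshold (P : 'I_q -> nat -> Prop) :
  (forall l, exists K, forall k, (K <= k)%N -> P l k) ->
  exists K, forall k, (K <= k)%N -> forall l, P l k.
Proof.
move=> /choice[K HK]; exists (\max_l K l) => k Kk l; apply: HK.
exact: leq_trans (leq_bigmax l) Kk.
Qed.

Lemma sparse_cone_truncated p : sparse_cone p ->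
  exists K, forall k, (K <= k)%N -> exists a b : 'I_q -> mpoly n R,
    [/\ forall l, in_ideal (Hs l) (U l) k (a l),
        forall l, in_qmodule (Gs l) (U l) k (b l)
      & p = \sum_l a l + \sum_l b l].
Proof.
move=> [a [b [aH bG pE]]].
have [K1 HK1] := uniform_threshold (fun l => ideal_truncated (aH l)).
have [K2 HK2] := uniform_threshold (fun l => qmodule_truncated (bG l)).
exists (maxn K1 K2) => k; rewrite geq_max => /andP[/HK1 ? /HK2 ?].
by exists a, b; split.
Qed.

End SparseCone.

(** * Homogenization and the reformulated problem *)

Section Homogenization.
Set Implicit Arguments.
Unset Strict Implicit.
Unset Printing Implicit Defensive.
Variables (R : realType) (n : nat).
Implicit Types (r : mpoly n R) (y : 'rV[R]_n.+1).

Lemma mdeg_degree r (a : multinom n) : a \in msupp r -> (mdeg a <= degree r)%N.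
Proof. by move=> ar; have := mmeasure_mnm_lt mdeg ar; rewrite /degree; case: (mmeasure _ _). Qed.

Lemma eval_homogenize r y : eval (homogenize r) y =
  \sum_(a <- msupp r) mcoeff a r * (y ord0 ord0 ^+ (degree r - mdeg a)
                                    * \prod_(i < n) y ord0 (lift ord0 i) ^+ a i).
Proof.
rewrite evalE; apply: eq_bigr => a _; rewrite !evalE; congr (_ * (_ * _)).
by apply: eq_bigr => i _; rewrite !evalE.
Qed.

Definition dehomogenize y : 'rV[R]_n :=
  \row_i (y ord0 (lift ord0 i) / y ord0 ord0).

Lemma eval_homogenize_neq0 r y : y ord0 ord0 != 0 ->
  eval (homogenize r) y = y ord0 ord0 ^+ degree r * eval r (dehomogenize y).
Proof.
move=> y0; rewrite eval_homogenize /eval mevalE mulr_sumr big_seq [RHS]big_seq.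
apply: eq_bigr => a ar; rewrite [RHS]mulrCA; congr (_ * _).
rewrite -{2}(subnK (mdeg_degree ar)) exprD -mulrA; congr (_ * _).
rewrite mdegE -prodrXr -big_split; apply: eq_bigr => i _ /=.
by rewrite mxE -exprMn mulrC divfK.
Qed.

(** On the hyperplane at infinity only the monomials of top degree survive. *)
Lemma eval_homogenize_eq0 r y : y ord0 ord0 = 0 ->
  eval (homogenize r) y = eval (top_form r) (\row_i y ord0 (lift ord0 i)).
Proof.
move=> y0; rewrite eval_homogenize /top_form pihomogE evalE [RHS]big_mkcond /=.
rewrite big_seq [RHS]big_seq; apply: eq_bigr => a ar.
rewrite y0 expr0n subn_eq0; have := mdeg_degree ar; rewrite eq_sym eqn_leq.
move=> ->; rewrite andbT; case: ifP => _; last by rewrite mul0r mulr0.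
rewrite mul1r evalZ /eval mevalX; congr (_ * _).
by apply: eq_bigr => i _; rewrite mxE.
Qed.

Lemma eval_rename N (s : 'I_n -> 'I_N) r (u : 'rV[R]_N) :
  eval (rename s r) u = eval r (\row_i u ord0 (s i)).
Proof.
move: r (in_polyringT r); apply: polyring_ind => [c|j _|r r'|r r'].
- by rewrite /rename mmapC !evalE.
- by rewrite /rename mmapX mmap1U !evalE mxE.
- by rewrite /rename (rmorphD (mmap _ _)) !evalE => -> ->.
- by rewrite /rename (rmorphM (mmap _ _)) !evalE => -> ->.
Qed.

End Homogenization.

Section Reformulation.
Set Implicit Arguments.
Unset Strict Implicit.
Unset Printing Implicit Defensive.
Variables (R : realType) (n m p : nat) (f : mpoly n R) (g : 'I_m -> mpoly n R).
Variable X : 'I_p -> {set 'I_n}.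
Hypotheses (p_gt0 : (0 < p)%N) (X_cover : \bigcup_l X l = [set: 'I_n]).
Local Notation N := (n.+1 + p)%N.
Implicit Types (u : 'rV[R]_N) (y : 'rV[R]_n.+1) (x : 'rV[R]_n).

Definition tilde_part u : 'rV[R]_n.+1 := \row_i u ord0 (ux p i).

Lemma eval_homogenize_u (r : mpoly n R) u :
  eval (homogenize_u p r) u = eval (homogenize r) (tilde_part u).
Proof. exact: eval_rename. Qed.

Lemma eval_objective (c : R) u : eval (objective p f c) u =
  eval (homogenize f) (tilde_part u) - c * tilde_part u ord0 ord0 ^+ degree f.
Proof. by rewrite evalB eval_homogenize_u !evalE mxE. Qed.

(** The mass that [y] puts on the clique of index [l], weighted so that the
    total over the cliques is the squared norm of [y]. *)
Definition clique_mass y l : R :=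
  \sum_(i in X l) (mult X i)%:R^-1 * y ord0 (lift ord0 i) ^+ 2
  + p%:R^-1 * y ord0 ord0 ^+ 2.

Lemma mult_gt0 i : (0 < mult X i)%N.
Proof.
rewrite /mult card_gt0; apply/set0Pn.
have : i \in \bigcup_l X l by rewrite X_cover inE.
by move=> /bigcupP[l _ il]; exists l; rewrite inE.
Qed.

Lemma sum_clique_mass y : \sum_l clique_mass y l = \sum_i y ord0 i ^+ 2.
Proof.
rewrite big_split /= sumr_const card_ord big_ord_recl addrC; congr (_ + _).
  by rewrite -[LHS]mulr_natl mulrA mulfV ?mul1r // pnatr_eq0 -lt0n.
rewrite (exchange_big_dep predT) //=; apply: eq_bigr => i _.
rewrite -mulr_suml sumr_const -[RHS]mul1r; congr (_ * _).
have -> : #|(fun l => i \in X l)| = mult X i.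
  by rewrite /mult; apply: eq_card => l; rewrite !inE.
by rewrite -[LHS]mulr_natr mulVf // pnatr_eq0 -lt0n mult_gt0.
Qed.

Lemma clique_mass_ge0 y l : 0 <= clique_mass y l.
Proof.
apply: addr_ge0; last by rewrite mulr_ge0 ?invr_ge0 ?sqr_ge0.
by apply: sumr_ge0 => i _; rewrite mulr_ge0 ?invr_ge0 ?sqr_ge0.
Qed.

Lemma eval_hsphere u l : eval (hsphere R X l) u =
  clique_mass (tilde_part u) l + u ord0 (uw n l) ^+ 2 - 1.
Proof.
rewrite /hsphere /clique_mass evalB !evalD eval1 !evalE !mxE.
by congr (_ + _ + _ - _); apply: eq_bigr => i _; rewrite !evalE mxE.
Qed.

Lemma eval_hlast u : eval (hlast R n p) u =
  \sum_l u ord0 (uw n l) ^+ 2 - p%:R + 1.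
Proof.
rewrite /hlast evalD evalB eval1 !evalE; congr (_ - _ + _).
  by apply: eq_bigr => i _; rewrite !evalE.
by rewrite -(rmorph_nat (@mpolyC N R)) evalE.
Qed.

(** The sum of the equations of the cliques minus the last equation is the
    equation of the unit sphere in the homogenized variables. *)
Lemma tilde_part_unit u : (forall j, eval (hprime R X j) u = 0) ->
  \sum_i tilde_part u ord0 i ^+ 2 = 1.
Proof.
move=> hu; have := hu ord_max; rewrite /hprime unlift_none eval_hlast.
have : \sum_l eval (hsphere R X l) u = 0.
  by apply: big1 => l _; have := hu (lift ord_max l); rewrite /hprime liftK.
under eq_bigr do rewrite eval_hsphere.
rewrite sumrB big_split /= sum_clique_mass sumr_const card_ord; lra.
Qed.

(** For [x_0 = 0] the positivity of the top form of [f] decides when the degree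
    of [f] is positive.  For a constant [f] the term [gamma * x_0 ^ 0] does not
    vanish at infinity, and this is where closedness at infinity enters. *)
Lemma objective_pos (c : R) u : (c%:E < f_min f g)%E ->
  closed_at_infinity g -> positive_at_infinity f g ->
  (forall j, 0 <= eval (homogenize_u p (g j)) u) -> 0 <= u ord0 (ux p ord0) ->
  (forall j, eval (hprime R X j) u = 0) -> 0 < eval (objective p f c) u.
Proof.
move=> cf gclosed fpos gu u0 /tilde_part_unit y1; rewrite eval_objective.
have {}gu j : 0 <= eval (homogenize (g j)) (tilde_part u).
  by rewrite -eval_homogenize_u.
have {}u0 : 0 <= tilde_part u ord0 ord0 by rewrite mxE.
move: (tilde_part u) y1 gu u0 => y y1 gy; rewrite le_eqVlt.
have fgt x : feasible g x -> c < eval f x.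
  move=> gx; rewrite -lte_fin; apply: lt_le_trans cf _.
  by apply: ereal_inf_lbound; exists x.
have dehom (z : 'rV[R]_n.+1) : 0 < z ord0 ord0 -> (forall j, 0 <= eval (homogenize (g j)) z) ->
    feasible g (dehomogenize z).
  move=> z0 gz j; have := gz j; rewrite eval_homogenize_neq0 ?gt_eqF //.
  by rewrite pmulr_rge0 // exprn_gt0.
move=> /predU1P[/esym y0|y0]; last first.
  rewrite eval_homogenize_neq0 ?gt_eqF // mulrC -mulrBl mulr_gt0 ?exprn_gt0 //.
  by rewrite subr_gt0; apply/fgt/dehom.
have [d0|d0] := posnP (degree f); last first.
  rewrite y0 expr0n eqn0Ngt d0 mulr0 subr0 eval_homogenize_eq0 //.
  apply: fpos; split=> [j|]; first by rewrite -eval_homogenize_eq0.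
  rewrite -[RHS]y1 big_ord_recl y0 expr0n add0r.
  by apply: eq_bigr => i _; rewrite mxE.
(* A point at infinity is a limit of finite ones, so a finite feasible point
   exists; it decides the sign of the constant objective. *)
have [z [[gz _ _] z0]] : exists z, feasible_tilde g z /\ 0 < z ord0 ord0.
  have gy0 : feasible_tilde g y by split => //; rewrite y0.
  rewrite gclosed in gy0.
  by have [z [[gz z0] _]] := gy0 classical_sets.setT filterT; exists z.
have := fgt _ (dehom z z0 gz).
have [b fb] : exists b, f = mpolyC n b.
  eexists; apply: msize1_polyC; move: d0; rewrite /degree.
  by case: (mmeasure _ _) => // -[].
rewrite eval_homogenize_eq0 // d0 expr0 mulr1 subr_gt0.
rewrite /top_form d0 pihomog_dE; first by rewrite fb !evalE.
by apply/dhomogP => a /mdeg_degree; rewrite d0 leqn0 => /eqP.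
Qed.

(** The point is [(1, x)] normalized to the unit sphere.  Each [w_l] solves the
    equation of its clique, which is possible because no clique carries more
    than the total mass 1. *)
Lemma reformulation_point x : feasible g x -> exists u,
  [/\ 0 < u ord0 (ux p ord0), dehomogenize (tilde_part u) = x,
      forall j, 0 <= eval (homogenize_u p (g j)) u,
      forall j, eval (hprime R X j) u = 0 &
      forall i, 0 <= eval (box R i) u].
Proof.
move=> gx.
pose t : R := (Num.sqrt (1 + \sum_i x ord0 i ^+ 2))^-1.
have S0 : 0 <= \sum_i x ord0 i ^+ 2 by apply: sumr_ge0 => i _; exact: sqr_ge0.
have t0 : 0 < t by rewrite invr_gt0 sqrtr_gt0 ltr_wpDr.
have t2 : t ^+ 2 * (1 + \sum_i x ord0 i ^+ 2) = 1.
  by rewrite exprVn sqr_sqrtr ?mulVf ?gt_eqF ?addr_ge0 // ltr_wpDr.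
pose y : 'rV[R]_n.+1 := \row_i (if unlift ord0 i is Some j then t * x ord0 j else t).
have yl j : y ord0 (lift ord0 j) = t * x ord0 j by rewrite mxE liftK.
have y0 : y ord0 ord0 = t by rewrite mxE unlift_none.
have y1 : \sum_i y ord0 i ^+ 2 = 1.
  rewrite big_ord_recl y0 -[RHS]t2 mulrDr mulr1 mulr_sumr; congr (_ + _).
  by apply: eq_bigr => i _; rewrite yl exprMn.
have mass_le1 l : clique_mass y l <= 1.
  rewrite -y1 -sum_clique_mass (bigD1 l) //= lerDl.
  by apply: sumr_ge0 => k _; exact: clique_mass_ge0.
pose u : 'rV[R]_N := row_mx y (\row_l Num.sqrt (1 - clique_mass y l)).
have uy : tilde_part u = y by apply/rowP => i; rewrite mxE row_mxEl.
have uwE l : u ord0 (uw n l) ^+ 2 = 1 - clique_mass y l.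
  by rewrite row_mxEr mxE sqr_sqrtr // subr_ge0.
exists u; split.
- by rewrite row_mxEl y0.
- apply/rowP => i; rewrite mxE uy yl y0 mulrC mulKf // gt_eqF //.
- move=> j; rewrite eval_homogenize_u uy eval_homogenize_neq0 ?y0 ?gt_eqF //.
  rewrite mulr_ge0 ?exprn_ge0 ?(ltW t0) //.
  have -> : dehomogenize y = x; last exact: gx.
  by apply/rowP => i; rewrite mxE yl y0 mulrC mulKf // gt_eqF.
- move=> j; rewrite /hprime; case: unliftP => [l _|_].
    by rewrite eval_hsphere uy uwE; ring.
  rewrite eval_hlast (eq_bigr _ (fun l _ => uwE l)) sumrB sum_clique_mass y1.
  by rewrite sumr_const card_ord; ring.
- move=> i; rewrite /box evalB eval1 evalX eval_mvar subr_ge0.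
  case: (split_ordP i) => [k ->|l ->].
    rewrite row_mxEl -[leRHS]y1 (bigD1 k) //= lerDl.
    by apply: sumr_ge0 => k' _; exact: sqr_ge0.
  by rewrite uwE gerBl clique_mass_ge0.
Qed.

End Reformulation.

(** * Convergence of the relaxations *)

Section Convergence.
Set Implicit Arguments.
Unset Strict Implicit.
Unset Printing Implicit Defensive.
Variable R : realType.

Lemma cvg_of_lower_bounds (a : \bar R) (b : nat -> \bar R) :
  (-oo < a)%E -> (forall k, (b k <= a)%E) ->
  (forall c : R, (c%:E < a)%E ->
     exists k0, forall k, (k0 <= k)%N -> (c%:E <= b k)%E) ->
  (b k @[k --> \oo] --> a)%classic.
Proof.
case: a => [r||] // _ bu bl; last first.
  apply/cvgeyPge => A; have [|k0 H] := bl A; first exact: ltry.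
  by exists k0 => // k /= /H.
have near_ge (e : R) : 0 < e -> exists k0, forall k, (k0 <= k)%N ->
    b k \is a fin_num /\ r - e <= fine (b k) <= r.
  move=> e0; have [|k0 H] := bl (r - e); first by rewrite lte_fin ltrBlDr ltrDl.
  exists k0 => k /H; have := bu k; case: (b k) => // s.
  by rewrite !lee_fin => -> ->.
apply/fine_cvgP; split.
  by have [k0 H] := near_ge 1 ltr01; exists k0 => // k /= /H[].
apply/cvgrPdist_le => e e0; have [k0 H] := near_ge e e0.
exists k0 => // k /= /H[_ /andP[h1 h2]].
by rewrite ger0_norm ?subr_ge0 //; lra.
Qed.

End Convergence.

Section Relaxations.
Set Implicit Arguments.
Unset Strict Implicit.
Unset Printing Implicit Defensive.
Variables (R : realType) (n m p q : nat) (f : mpoly n R) (g : 'I_m -> mpoly n R).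
Variables (X : 'I_p -> {set 'I_n}) (U : 'I_q -> {set 'I_(n.+1 + p)}).
Variables (Ipart : 'I_p.+1 -> 'I_q) (Jpart : 'I_m -> 'I_q).
Hypotheses (p_gt0 : (0 < p)%N) (X_cover : \bigcup_l X l = [set: 'I_n]).
Local Notation N := (n.+1 + p)%N.

Lemma in_clique_ineqs l h :
  h \in clique_ineqs g U Jpart l ->
  [\/ h = mvar R (ux p ord0), exists2 i, i \in U l & h = box R i
    | exists2 j, Jpart j = l & h = homogenize_u p (g j)].
Proof.
rewrite inE => /orP[/eqP->|]; first by constructor 1.
rewrite mem_cat => /orP[/mapP[i]|/mapP[j]].
  by rewrite mem_enum => iU ->; constructor 2; exists i.
by rewrite mem_filter => /andP[/eqP jl _] ->; constructor 3; exists j.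
Qed.

Lemma relaxation_sound k (c : R) x : relaxation_feasible f g X U Ipart Jpart k c ->
  feasible g x -> c <= eval f x.
Proof.
move=> [a [b [aI bQ objE]]] /(reformulation_point p_gt0 X_cover).
move=> [u [u0 ux gu hu boxu]].
have a0 l : eval (a l) u = 0.
  have [s _ ->] := aI l; rewrite evalE big_seq big1 // => h.
  by rewrite mem_undup => /mapP[j _ ->]; rewrite evalE hu mul0r.
have b0 l : 0 <= eval (b l) u.
  have [s0 [s [[_ [t _ s0E]] sS ->]]] := bQ l.
  rewrite evalD evalE addr_ge0 //.
    by rewrite s0E evalE sumr_ge0 // => r _; rewrite evalE sqr_ge0.
  rewrite big_seq sumr_ge0 // => h; rewrite mem_undup => hG.
  have [_ [t' _ ->]] := sS h hG; rewrite evalM mulr_ge0 //; last first.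
    by rewrite evalE sumr_ge0 // => r _; rewrite evalE sqr_ge0.
  case: (in_clique_ineqs hG) => [->|[i _ ->]|[j _ ->]] //.
  by rewrite evalE ltW.
have : 0 <= eval (objective p f c) u.
  rewrite objE evalE !eval_sum; apply: addr_ge0; apply: sumr_ge0 => l _ //.
  by rewrite a0.
have t0 : 0 < tilde_part u ord0 ord0 by rewrite mxE.
rewrite eval_objective eval_homogenize_neq0 ?gt_eqF // ux.
by rewrite [c * _]mulrC -mulrBr pmulr_rge0 ?exprn_gt0 // subr_ge0.
Qed.

Lemma f_bar_le_f_min k : (f_bar f g X U Ipart Jpart k <= f_min f g)%E.
Proof.
apply: ge_ereal_sup => _ [c cF <-]; apply: le_ereal_inf_tmp => _ [x gx <-].
by rewrite lee_fin; exact: relaxation_sound cF gx.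
Qed.

Variable E : rel 'I_N.
Hypotheses (E_ext : chordal_extension E (csp_adj f g X))
  (U_cliques : lists_maximal_cliques E U).

Lemma clique_in_list K : clique E K -> exists l, K \subset U l.
Proof.
move=> /maxset_exists[C Cmax KC]; have [_ UC] := U_cliques.
by have /UC[l Ul] := Cmax; exists l; rewrite Ul.
Qed.

Lemma clique_list l : clique E (U l).
Proof.
have [_ UC] := U_cliques; apply: maxsetp.
by apply/UC; exists l.
Qed.

Lemma var_in_list i : exists l, i \in U l.
Proof.
have [|l] := @clique_in_list [set i]; last by rewrite sub1set; exists l.
apply/forall_inP => a; rewrite inE => /eqP->; apply/forall_inP => b.
by rewrite inE => /eqP->; rewrite eqxx.
Qed.

Lemma sparse_objective (c : R) : sparse E (objective p f c).
Proof.
move=> a aobj; apply/forall_inP => i ia; apply/forall_inP => j ja.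
apply/implyP => ij; have [_ _ adjE _] := E_ext; apply: adjE; split => //.
by left; exists c, a; rewrite // ia.
Qed.

Hypotheses (Jpart_in : forall j, in_polyring (U (Jpart j)) (homogenize_u p (g j)))
  (Ipart_in : forall j, in_polyring (U (Ipart j)) (hprime R X j)).

Local Notation cone :=
  (sparse_cone U (clique_eqs R X Ipart) (clique_ineqs g U Jpart)).

Lemma cone_clique K r : clique E K -> in_polyring K r ->
  (forall u, cube N%:R u -> 0 < eval r u) -> cone r.
Proof.
move=> /clique_in_list[l KU] rK rpos; apply: (@sparse_cone_qmodule _ _ _ _ _ _ l).
apply: (@ball_module_qmodule _ _ _ (U l)) => [i iU|].
  by rewrite -[1 - _]/(box R i) inE mem_cat map_f ?orbT // mem_enum.
have N0 : 0 < N%:R :> R by rewrite ltr0n.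
apply: cube_positivstellensatz N0 _ _ (in_polyringS KU rK) rpos.
apply: arch_ball_module => //; rewrite -natrX ler_nat.
apply: leq_trans (max_card _) _; rewrite card_ord -mulnn.
by rewrite leq_pmulr.
Qed.

(** The equations enter as inequalities [- h ^ 2 >= 0]: a square multiple
    [s ^ 2 * - h ^ 2] is the multiple of [h] by [- (s ^ 2 * h)]. *)
Lemma cone_constraint h :
  h \in mvar R (ux p ord0) :: codom (fun j => homogenize_u p (g j))
    ++ codom (fun j => - hprime R X j ^+ 2) ++ codom (@box R n p) ->
  exists K, [/\ clique E K, in_polyring K h &
    forall s, in_polyring K s -> cone (s ^+ 2 * h)].
Proof.
have ineq l : in_polyring (U l) h -> h \in clique_ineqs g U Jpart l ->
    exists K, [/\ clique E K, in_polyring K h &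
      forall s, in_polyring K s -> cone (s ^+ 2 * h)].
  move=> hU hG; exists (U l); split => //; first exact: clique_list.
  move=> s sU; rewrite mulrC; apply: (@sparse_cone_qmodule _ _ _ _ _ _ l).
  by apply: qmodule_gen => //; exact: sos_sqr.
rewrite inE !mem_cat => /or4P[/eqP hE|/codomP[j hE]|/codomP[j hE]|/codomP[i hE]].
- have [l x0U] := var_in_list (ux p ord0).
  apply: (ineq l); first by rewrite hE; exact: in_polyring_mvar.
  by rewrite hE inE eqxx.
- apply: (ineq (Jpart j)); first by rewrite hE.
  rewrite hE inE mem_cat (map_f (fun j => homogenize_u p (g j))) ?orbT //.
  by rewrite mem_filter eqxx mem_enum.
- exists (U (Ipart j)); split; first exact: clique_list.
    by rewrite hE; apply: in_polyringN; exact: in_polyringX.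
  move=> s sU; apply: (@sparse_cone_ideal _ _ _ _ _ _ (Ipart j)).
  rewrite hE (_ : _ * _ = hprime R X j * (- (s ^+ 2 * hprime R X j))); last by ring.
  apply: ideal_gen; last by apply/in_polyringN/in_polyringM => //; exact: in_polyringX.
  by rewrite map_f // mem_filter eqxx mem_enum.
- have [l iU] := var_in_list i; apply: (ineq l); rewrite hE.
    apply: in_polyringB; first exact: in_polyring1.
    by apply: in_polyringX; exact: in_polyring_mvar.
  by rewrite inE mem_cat map_f ?orbT // mem_enum.
Qed.

Hypotheses (g_closed : closed_at_infinity g) (f_pos : positive_at_infinity f g).

Lemma cone_objective (c : R) : (c%:E < f_min f g)%E -> cone (objective p f c).
Proof.
move=> cf; have [E_sym E_irr _ E_chordal] := E_ext.
have N0 : 0 < N%:R :> R by rewrite ltr0n.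
apply: (sparse_positivstellensatz N0 E_sym E_irr E_chordal
  (@sparse_coneD _ _ _ _ _ _) cone_clique (@sparse_objective c) cone_constraint).
move=> u _ hu; apply: (objective_pos p_gt0 X_cover cf g_closed f_pos).
- by move=> j; apply: hu; rewrite inE !mem_cat codom_f orbT.
- by have := hu (mvar R (ux p ord0)); rewrite evalE; apply; rewrite inE eqxx.
- move=> j; have := hu (- hprime R X j ^+ 2).
  rewrite !evalE oppr_ge0 => H; apply/eqP; rewrite -sqrf_eq0 eq_le sqr_ge0 H //.
  by rewrite inE !mem_cat (codom_f (fun j => - hprime R X j ^+ 2)) !orbT.
Qed.

Lemma f_bar_ge (c : R) : (c%:E < f_min f g)%E ->
  exists k0, forall k, (k0 <= k)%N -> (c%:E <= f_bar f g X U Ipart Jpart k)%E.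
Proof.
move=> /cone_objective/sparse_cone_truncated[k0 Hk0]; exists k0 => k /Hk0 ck.
by apply: ereal_sup_ubound; exists c.
Qed.

End Relaxations.

Theorem theorem4p2 (R : realType) (n m p q : nat)
    (f : mpoly n R) (g : 'I_m -> mpoly n R)
    (X : 'I_p -> {set 'I_n})
    (E : rel 'I_(n.+1 + p)) (U : 'I_q -> {set 'I_(n.+1 + p)})
    (Ipart : 'I_p.+1 -> 'I_q) (Jpart : 'I_m -> 'I_q) :
  (0 < p)%N ->
  (-oo < f_min f g)%E ->
  closed_at_infinity g ->
  positive_at_infinity f g ->
  is_csp f g X ->
  chordal_extension E (csp_adj f g X) ->
  lists_maximal_cliques E U ->
  (forall j, in_polyring (U (Jpart j)) (homogenize_u p (g j))) ->
  (forall j, in_polyring (U (Ipart j)) (hprime R X j)) ->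
  (f_bar f g X U Ipart Jpart k @[k --> \oo] --> f_min f g)%classic.
Proof.
move=> p0 fmin gclosed fpos [Xcover _ _] Eext Ucl JU IU.
apply: cvg_of_lower_bounds => // [k|c cf]; first exact: f_bar_le_f_min.
exact: f_bar_ge p0 Xcover _ Eext Ucl JU IU gclosed fpos _ cf.
Qed.
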